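(* Let $N,M\ge2$, let $U=(u_{i,j})$ be a real $N\times M$ matrix, and assume that the zero-sum bilinear game with payoff matrix $U$ has a fully mixed Nash equilibrium $(p,q)$. Consider the system $$\dot{\theta}_i=-\nabla f_i(\theta_i)\Big(\sum_{j=1}^M u_{i,j}g_j(\phi_j)+\lambda\Big),\qquad \dot{\phi}_j=\nabla g_j(\phi_j)\Big(\sum_{i=1}^N u_{i,j}f_i(\theta_i)+\mu\Big),$$ $$\dot{\mu}=-\Big(\sum_{j=1}^M g_j(\phi_j)-1\Big),\qquad \dot{\lambda}=\sum_{i=1}^N f_i(\theta_i)-1 .$$ (a) If all $f_i$ and $g_j$ are the sigmoid function $\sigma:\mathbb{R}\to\mathbb{R}$, $\sigma(x)=(1+e^{-x})^{-1}$ (so $\theta_i,\phi_j\in\mathbb{R}$), then the flow of this system is Poincar\'e recurrent. (b) The same conclusion holds for all smooth functions $f_i:\mathbb{R}^{n_i}\to[0,\infty)$ and $g_j:\mathbb{R}^{m_j}\to[0,\infty)$ that are one-to-one and for which all initializations are safe.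
   Context: Here $1\le i\le N$, $1\le j\le M$, $\theta=(\theta_1,\dots,\theta_N)$, $\phi=(\phi_1,\dots,\phi_M)$, and $\lambda,\mu\in\mathbb{R}$ are Lagrange multipliers. The system is continuous-time gradient-descent-ascent for $\min_{\theta,\mu}\max_{\phi,\lambda}\ F(\theta)^\top U G(\phi)+\lambda(\sum_i f_i(\theta_i)-1)+\mu(\sum_j g_j(\phi_j)-1)$ with $F=(f_i)_i$, $G=(g_j)_j$. A fully mixed Nash equilibrium $(p,q)$ of the game $U$ is a pair of probability vectors $p\in\mathbb{R}^N$, $q\in\mathbb{R}^M$ with all entries strictly positive such that $p$ minimizes $x\mapsto x^\top Uq$ over probability vectors $x$ and $q$ maximizes $y\mapsto p^\top Uy$ over probability vectors $y$. The gradient ascent flows of all $f_i$ and $g_j$ are assumed to be defined for all times. For each $i$, let $\gamma_i:\mathbb{R}\to\mathbb{R}^{n_i}$ solve $\dot\gamma_i=\nabla f_i(\gamma_i)$, $\gamma_i(0)=\theta_i(0)$, and define $f_{i,\theta_i(0)}=\{f_i(\gamma_i(s)):s\in\mathbb{R}\}$; $g_{j,\phi_j(0)}$ is defined in the same way from $g_j$ and $\phi_j(0)$. An initialization $(\theta(0),\phi(0),\lambda(0),\mu(0))$ is called safe if, for all $i,j$, $\theta_i(0)$ is not a stationary point of $f_i$, $\phi_j(0)$ is not a stationary point of $g_j$, $p_i\in f_{i,\theta_i(0)}$ and $q_j\in g_{j,\phi_j(0)}$. For a flow $\Phi$ on $\mathbb{R}^d$, a point $x$ is recurrent if for every neighborhood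 $W$ of $x$ there is an increasing sequence of times $t_k\to\infty$ with $\Phi(x,t_k)\in W$ for all $k$. The flow is Poincar\'e recurrent if the set of non-recurrent points (in the whole state space of $(\theta,\phi,\lambda,\mu)$) has Lebesgue measure zero. *)

(* Defs.v *)
From mathcomp Require Import all_boot all_order all_algebra.
From mathcomp Require Import all_classical all_reals all_analysis.

Set Implicit Arguments.
Unset Strict Implicit.
Unset Printing Implicit Defensive.

Import Order.TTheory GRing.Theory Num.Theory.
Import numFieldNormedType.Exports.

Local Open Scope classical_set_scope.
Local Open Scope ring_scope.

Section Gradient.
Context {R : realType} {n : nat}.
Implicit Type f : 'rV[R]_n -> R.

Definition grad f (x : 'rV[R]_n) : 'rV[R]_n :=
  \row_k 'D_(delta_mx 0 k) f x.

(* All iterated partial derivatives of order at most k exist and are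
   continuous. *)
Fixpoint class_C (k : nat) f : Prop :=
  continuous f /\
  if k is k'.+1 then
    forall i : 'I_n, (forall x, derivable f x (delta_mx 0 i)) /\
                     class_C k' (fun x => 'D_(delta_mx 0 i) f x)
  else True.

Definition smooth f : Prop := forall k, class_C k f.

End Gradient.

Section Flows.
Context {R : realType} {d : nat}.
Implicit Types (V : 'rV[R]_d -> 'rV[R]_d) (Phi : 'rV[R]_d -> R -> 'rV[R]_d).

Definition integral_curve V (c : R -> 'rV[R]_d) : Prop :=
  forall t : R, is_derive t (1 : R) c (V (c t)).

(* Phi is the (global) flow of V: every point has a unique integral curve
   defined on the whole of R, and Phi x is that curve. *)
Definition is_flow V Phi : Prop :=
  forall x, [/\ Phi x 0 = x, integral_curve V (Phi x) &
                forall c, integral_curve V c -> c 0 = x -> c =1 Phi x].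

Definition recurrent Phi (x : 'rV[R]_d) : Prop :=
  forall W : set 'rV[R]_d, nbhs x W ->
  exists t : R^nat, [/\ increasing_seq t, t @ \oo --> +oo &
                        forall k, W (Phi x (t k))].

(* d-dimensional Lebesgue outer measure: infimum of the total volume of
   countable covers by boxes. *)
Definition box (ab : 'rV[R]_d * 'rV[R]_d) : set 'rV[R]_d :=
  [set x | forall k, ab.1 0 k <= x 0 k <= ab.2 0 k].

Definition box_volume (ab : 'rV[R]_d * 'rV[R]_d) : R :=
  \prod_(k < d) (ab.2 0 k - ab.1 0 k).

Definition lebesgue_outer (A : set 'rV[R]_d) : \bar R :=
  ereal_inf [set (\sum_(0 <= l <oo) (box_volume (B l))%:E)%E |
    B in [set B : nat -> 'rV[R]_d * 'rV[R]_d |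
           (forall l k, (B l).1 0 k <= (B l).2 0 k) /\
           A `<=` \bigcup_l box (B l)]].

Definition poincare_recurrent Phi : Prop :=
  lebesgue_outer [set x | ~ recurrent Phi x] = 0%E.

Definition has_poincare_recurrent_flow V : Prop :=
  exists2 Phi, is_flow V Phi & poincare_recurrent Phi.

End Flows.

Section Game.
Context {R : realType} {N M : nat}.

Definition probability_vector {k : nat} (x : 'cV[R]_k) : Prop :=
  (forall i, 0 <= x i 0) /\ \sum_i x i 0 = 1.

(* The cost of the row player, who minimizes. *)
Definition payoff (U : 'M[R]_(N, M)) (x : 'cV[R]_N) (y : 'cV[R]_M) : R :=
  (x^T *m U *m y) 0 0.

Definition fully_mixed_nash (U : 'M[R]_(N, M)) (p : 'cV[R]_N) (q : 'cV[R]_M) :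
    Prop :=
  [/\ probability_vector p /\ probability_vector q,
      (forall i, 0 < p i 0) /\ (forall j, 0 < q j 0),
      (forall x, probability_vector x -> payoff U p q <= payoff U x q) &
      (forall y, probability_vector y -> payoff U p y <= payoff U p q)].

End Game.

Section GradientDescentAscent.
Context {R : realType} {N M : nat} {n : 'I_N -> nat} {m : 'I_M -> nat}.

Local Notation state := 'rV[R]_(\sum_i n i + \sum_j m j + (1 + 1)).

(* The point (theta, phi, lambda, mu) of the state space, as one row vector. *)
Definition mk_state (theta : forall i, 'rV[R]_(n i))
    (phi : forall j, 'rV[R]_(m j)) (lambda mu : R) : state :=
  row_mx (row_mx (\mxrow_i theta i) (\mxrow_j phi j))
         (row_mx lambda%:M mu%:M).

Definition theta_of (x : state) (i : 'I_N) : 'rV[R]_(n i) :=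
  submxrow (lsubmx (lsubmx x)) i.
Definition phi_of (x : state) (j : 'I_M) : 'rV[R]_(m j) :=
  submxrow (rsubmx (lsubmx x)) j.
Definition lambda_of (x : state) : R := lsubmx (rsubmx x) 0 0.
Definition mu_of (x : state) : R := rsubmx (rsubmx x) 0 0.

Variables (U : 'M[R]_(N, M)) (f : forall i, 'rV[R]_(n i) -> R)
          (g : forall j, 'rV[R]_(m j) -> R).

Definition gda_field (x : state) : state :=
  mk_state
    (fun i => - (\sum_j U i j * g (phi_of x j) + lambda_of x) *:
              grad (@f i) (theta_of x i))
    (fun j => (\sum_i U i j * f (theta_of x i) + mu_of x) *:
              grad (@g j) (phi_of x j))
    (\sum_i f (theta_of x i) - 1)
    (- (\sum_j g (phi_of x j) - 1)).

Definition ascent_complete {k : nat} (h : 'rV[R]_k -> R) : Prop :=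
  forall x, exists2 gamma, integral_curve (grad h) gamma & gamma 0 = x.

(* Values of h along the gradient ascent curve started at x. *)
Definition ascent_values {k : nat} (h : 'rV[R]_k -> R) (x : 'rV[R]_k) : set R :=
  [set v | exists gamma, [/\ integral_curve (grad h) gamma, gamma 0 = x &
                             exists s : R, v = h (gamma s)]].

Definition safe (p : 'cV[R]_N) (q : 'cV[R]_M) (x : state) : Prop :=
  (forall i, grad (@f i) (theta_of x i) <> 0 /\
             ascent_values (@f i) (theta_of x i) (p i 0)) /\
  (forall j, grad (@g j) (phi_of x j) <> 0 /\
             ascent_values (@g j) (phi_of x j) (q j 0)).

End GradientDescentAscent.

Definition sigmoid {R : realType} (x : R) : R := (1 + expR (- x))^-1.

(* The sigmoid with its argument in the one-dimensional space 'rV_1. *)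
Definition sigmoid_rV {R : realType} (x : 'rV[R]_1) : R := sigmoid (x 0 0).

(* Main.v *)
Require Import Defs.
From mathcomp Require Import all_boot all_order all_algebra.
From mathcomp Require Import all_classical all_reals all_analysis.
From mathcomp Require Import ring lra.
Import Order.TTheory GRing.Theory Num.Theory.
Import numFieldNormedType.Exports.
Local Open Scope classical_set_scope.
Local Open Scope ring_scope.

(** The system is a separable Hamiltonian system in disguise, and Poincare's
    recurrence theorem applies to it.

    A continuous injection into the line has at most one variable, and a
    gradient that is nowhere zero needs at least one, so that all the [theta_i]
    and [phi_j] are real numbers ([continuous_injective_dim],
    [safe_smooth_dim]). Against a fully mixed equilibrium all pure strategies
    are equally good; subtracting from each variable its equilibrium value
    ([p_i], [q_j], and minus the value of the game for [lambda] and [mu]) turns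
    the equations into
      [y_k' = F_k'(y_k) * sum_l J k l * (F_l(y_l) - p_l)]
    with a constant skew matrix [J] ([gda_field_gradient_form]). With the time
    of the gradient flow of [F_k] as a new coordinate [x_k], that is
    [y_k = gam_k(x_k)], they become
      [x_k' = sum_l J k l * c_l(x_l)], with [c_l = F_l o gam_l - p_l]
    strictly increasing and vanishing somewhere ([travel_time],
    [gradient_field_recurrence]).

    This field is [J] times the gradient of [H x = sum_l C_l(x_l)], where
    [C_l' = c_l]. Since [J] is skew, [H] is conserved; since the [c_l] increase
    through zero, the sublevel sets of [H] are compact. Hence clamping the
    arguments of the [c_l] far out does not change the motions of a given energy
    ([truncated_flow]) and leaves a globally Lipschitz field, whose flow exists
    by Picard iteration and is unique by Gronwall's inequality.

    Moreover the [k]-th component of the field does not depend on [x_k], so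
    that volume is preserved. Instead of differentiating the flow, one
    approximates it by moving the coordinates one after the other. Each such
    move is a shear, and shears preserve the outer measure because thin boxes
    are moved almost rigidly ([lebesgue_outer_shear_le]); in the limit, the
    volume of a compact set cannot decrease along the flow
    ([lebesgue_outer_flow]). As the outer measure is additive on disjoint
    compact sets, a compact set in a sublevel set of [H] whose images at the
    multiples of some time are pairwise disjoint is null ([wandering_null]), and
    countably many such sets contain all the points of that sublevel set that
    are not recurrent ([recurrence_on_invariant_set]). The coordinate change is
    Lipschitz on bounded sets and acts on each coordinate separately, so that it
    carries null sets to null sets ([coordinates_null]).

    For the sigmoid the gradient flow is complete because the derivative of the
    sigmoid is Lipschitz, and the equilibrium weights are values of the sigmoid
    because they lie strictly between 0 and 1. *)

Set Implicit Arguments.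
Unset Strict Implicit.
Unset Printing Implicit Defensive.

(** * Antiderivatives and comparison of functions by their derivatives *)

Lemma derive_ge0_le (R : realType) (h dh : R -> R) (a b : R) : a <= b ->
  (forall t, a <= t <= b -> is_derive t 1 h (dh t)) ->
  (forall t, a <= t <= b -> 0 <= dh t) -> h a <= h b.
Proof.
move=> ab hd dh0.
have [||c cab e] := @MVT_segment R h dh a b ab.
- move=> x; rewrite in_itv /= => /andP[ax xb].
  by apply: hd; rewrite !ltW.
- apply: derivable_within_continuous => x; rewrite in_itv /= => xab.
  by have [] := hd _ xab.
- by move: cab; rewrite in_itv /= => cab; rewrite -subr_ge0 e mulr_ge0 ?subr_ge0// dh0.
Qed.

Lemma derive_le_dist (R : realType) (y dy g dg : R -> R) (a b : R) : a <= b ->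
  (forall t, a <= t <= b -> is_derive t 1 y (dy t)) ->
  (forall t, a <= t <= b -> is_derive t 1 g (dg t)) ->
  (forall t, a <= t <= b -> `|dy t| <= dg t) ->
  `|y b - y a| <= g b - g a.
Proof.
move=> ab hy hg le; rewrite ler_norml; apply/andP; split.
- have := @derive_ge0_le R (g + y) (fun t => dg t + dy t) a b ab.
  rewrite /= => H; have {}H : (g + y) a <= (g + y) b.
    apply: H => t tab.
      by have := hy t tab; have := hg t tab => *; exact: is_deriveD.
    by have := le t tab; rewrite ler_norml => /andP[]; lra.
  by move: H; rewrite !fctE; lra.
- have := @derive_ge0_le R (g - y) (fun t => dg t - dy t) a b ab.
  rewrite /= => H; have {}H : (g - y) a <= (g - y) b.
    apply: H => t tab.
      by have := hy t tab; have := hg t tab => *; exact: is_deriveB.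
    by have := le t tab; rewrite ler_norml => /andP[]; lra.
  by move: H; rewrite !fctE; lra.
Qed.

Lemma derive_eq_sub (R : realType) (y z dy : R -> R) (a b : R) : a <= b ->
  (forall t, a <= t <= b -> is_derive t 1 y (dy t)) ->
  (forall t, a <= t <= b -> is_derive t 1 z (dy t)) ->
  y b - y a = z b - z a.
Proof.
move=> ab hy hz; apply/eqP; rewrite -subr_eq0 -normr_le0.
have := @derive_le_dist R (y - z) (fun t => dy t - dy t) (fun=> 0) (fun=> 0) a b ab.
rewrite subrr => H.
have -> : y b - y a - (z b - z a) = (y - z) b - (y - z) a by rewrite !fctE; lra.
apply: H => t tab.
- by have := hy t tab; have := hz t tab => *; exact: is_deriveB.
- by rewrite subrr normr0.
Qed.

(** The integral from [- n] is an antiderivative between [- n] and [n]; normalized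
    at 0, these functions agree for different [n] and define one on the line. *)
Lemma antiderivative (R : realType) (f : R -> R) : continuous f ->
  exists F : R -> R, F 0 = 0 /\ forall t : R, is_derive t (1 : R) F (f t).
Proof.
move=> cf.
pose mu := @lebesgue_measure R.
pose G (n : nat) (t : R) := (\int[mu]_(s in `[- n%:R, t]) f s)%R.
have dG (n : nat) (t : R) : `|t| < n%:R -> is_derive t (1 : R) (G n) (f t).
  rewrite ltr_norml => /andP[nt tn].
  have [] := @continuous_FTC1_closed R f (- n%:R) t n%:R tn _ nt (cf t).
    apply: continuous_compact_integrable; first exact: segment_compact.
    exact: continuous_subspaceT.
  by move=> d e; apply: DeriveDef => //; rewrite -derive1E.
pose F (t : R) := G (Num.truncn `|t|).+1 t - G (Num.truncn `|t|).+1 0.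
have FE (n : nat) (t : R) : `|t| < n%:R -> F t = G n t - G n 0.
  move=> tn; rewrite /F.
  set m := (Num.truncn _).+1.
  have tm : `|t| < m%:R by rewrite truncnS_gt.
  have [t0|t0] := leP 0 t.
    have st (s : R) : 0 <= s <= t -> `|s| <= `|t|.
      by move=> /andP[s0 ?]; rewrite !ger0_norm.
    by apply: (derive_eq_sub (dy := f)) => // s /st ?; apply: dG;
      apply: le_lt_trans; eassumption.
  have st (s : R) : t <= s <= 0 -> `|s| <= `|t|.
    by move=> /andP[? s0]; rewrite !ler0_norm ?lerN2// ltW.
  apply: oppr_inj; rewrite !opprB; apply: (derive_eq_sub (dy := f)); first exact: ltW.
  1,2: by move=> s /st ?; apply: dG; apply: le_lt_trans; eassumption.
exists F; split; first by rewrite (FE 1%N) ?normr0// subrr.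
move=> t; pose n := (Num.truncn `|t|).+1.
have tn : `|t| < n%:R by rewrite truncnS_gt.
have := dG n t tn => dGt.
have dH : is_derive t (1 : R) (fun s => G n s - G n 0) (f t).
  by apply: is_derive_eq; rewrite subr0.
apply: near_eq_is_derive dH; near=> s; rewrite (FE n)//.
near: s; apply: (@cvgr_lt _ _ (nbhs t) _ (fun s : R => `|s|) `|t|) => //.
exact: (cvg_norm (@cvg_id _ _)).
Unshelve. all: by end_near. Qed.

(** * Rows of real numbers and growth estimates *)

Lemma le_coord_norm (R : realType) (d : nat) (x : 'rV[R]_d) k : `|x 0 k| <= `|x|.
Proof.
rewrite [leRHS]/Num.Def.normr /= mx_normrE.
exact: (le_bigmax _ (fun i : 'I_1 * 'I_d => `|x i.1 i.2|) (0, k)).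
Qed.

Lemma norm_le_coord (R : realType) (d : nat) (x : 'rV[R]_d) (r : R) :
  0 <= r -> (forall k, `|x 0 k| <= r) -> `|x| <= r.
Proof.
move=> r0 xr; rewrite [leLHS]/Num.Def.normr /= mx_normrE.
by apply/bigmax_leP; split => // -[i k] _ /=; rewrite ord1.
Qed.

Lemma near_dist_le (R : realType) (W : normedModType R) (x : W) (e : R) :
  0 < e -> \forall y \near x, `|x - y| <= e.
Proof.
move=> e0; apply: filterS (nbhsx_ballx x e e0) => y.
by rewrite -ball_normE /= => /ltW.
Qed.

Lemma near_dist_le_row (R : realType) (d : nat) (x : 'rV[R]_d) (e : R) :
  0 < e -> \forall y \near x, `|x - y| <= e.
Proof. by move=> e0; have := @near_dist_le R 'rV[R]_d x e e0. Qed.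

Lemma continuous_at_dist (R : realType) (W W' : normedModType R) (h : W -> W') x :
  (forall e, 0 < e -> \forall y \near x, `|h x - h y| <= e) ->
  {for x, continuous h}.
Proof. by move=> hx; apply/cvgrPdist_le. Qed.

Lemma is_derive_rowP (R : realType) (d : nat) (c : R -> 'rV[R]_d) (t : R) v :
  is_derive t (1 : R) c v <->
  forall k, is_derive t (1 : R) (fun s => c s 0 k) (v 0 k).
Proof.
split=> [[dc <-] k|dc].
  have dck := (derivable_mxP c t 1).1 dc 0 k.
  by apply: DeriveDef => //; rewrite derive_mx// mxE.
have dc' : derivable c t 1.
  by apply/derivable_mxP => i k; rewrite ord1; case: (dc k).
apply: DeriveDef => //; rewrite derive_mx//; apply/rowP => k.
by rewrite mxE; case: (dc k).
Qed.

Lemma is_derive_continuous (R : realType) (V : normedModType R) (c : R -> V) dc :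
  (forall t : R, is_derive t (1 : R) c (dc t)) -> continuous c.
Proof.
move=> h t; apply: differentiable_continuous; apply/derivable1_diffP.
by case: (h t).
Qed.

Lemma is_derive_mul_fun (R : realType) (y z : R -> R) (t dy dz : R) :
  is_derive t (1 : R) y dy -> is_derive t (1 : R) z dz ->
  is_derive t (1 : R) (fun s => y s * z s) (dy * z t + y t * dz).
Proof.
move=> hy hz; apply: (is_derive_eq (is_deriveM hy hz)).
by rewrite /GRing.scale /=; ring.
Qed.

Lemma is_derive_sum_fun (R : realType) (d : nat) (y : 'I_d -> R -> R) (t : R) dy :
  (forall k, is_derive t (1 : R) (y k) (dy k)) ->
  is_derive t (1 : R) (fun s => \sum_k y k s) (\sum_k dy k).
Proof.
move=> hy; have -> : (fun s => \sum_k y k s) = \sum_k y k.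
  by apply/funext => s; rewrite fct_sumE.
exact: is_derive_sum.
Qed.

Lemma is_derive_exp_scaled (R : realType) (C A t : R) :
  is_derive t (1 : R) (fun s => C * expR (A * s)) (C * (A * expR (A * t))).
Proof.
have h1 : is_derive t (1 : R) (fun s => A * s) A.
  by apply: is_derive_eq; rewrite scaler1.
have h2 := is_derive1_comp (is_derive_expR (A * t)) h1.
have -> : (fun s => C * expR (A * s)) = C *: (expR \o (fun s => A * s)).
  by apply/funext.
by apply: is_derive_eq; rewrite mulrC [A * _]mulrC mulrC.
Qed.

(** Integrating a bound that grows like [C A exp(A |t|)] yields one that grows
    like [C exp(A |t|)]: iterating an integral operator with Lipschitz constant
    [A / 2] halves the constant [C] at each step, for all times at once. *)
Lemma exp_growth_bound (R : realType) (y dy : R -> R) (C A : R) : 0 <= C ->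
  (forall t : R, is_derive t (1 : R) y (dy t)) -> y 0 = 0 ->
  (forall t, `|dy t| <= C * (A * expR (A * `|t|))) ->
  forall t, `|y t| <= C * expR (A * `|t|).
Proof.
move=> C0 hy y0 le t; have [t0|t0] := leP 0 t.
- have := @derive_le_dist R y dy (fun s => C * expR (A * s))
    (fun s => C * (A * expR (A * s))) 0 t t0.
  rewrite y0 subr0 mulr0 expR0 mulr1 (ger0_norm t0) => H.
  apply: le_trans (H _ _ _) _ => //.
  + by move=> s _; exact: is_derive_exp_scaled.
  + by move=> s /andP[s0 _]; have := le s; rewrite (ger0_norm s0).
  + by rewrite gerBl.
- have := @derive_le_dist R y dy (fun s => - C * expR (- A * s))
    (fun s => - C * (- A * expR (- A * s))) t 0 (ltW t0).
  rewrite y0 sub0r normrN mulr0 expR0 mulr1 (ltr0_norm t0) => H.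
  apply: le_trans (H _ _ _) _ => //.
  + by move=> s _; exact: is_derive_exp_scaled.
  + move=> s /andP[_ s0]; have := le s; rewrite (ler0_norm s0).
    by rewrite mulrN !mulNr mulrN opprK.
  + by rewrite mulrN !mulNr opprK gerDr oppr_le0.
Qed.

Lemma gronwall (R : realType) (E dE : R -> R) (A : R) :
  (forall t : R, is_derive t (1 : R) E (dE t)) ->
  (forall t, `|dE t| <= A * E t) ->
  forall t, E t <= E 0 * expR (A * `|t|).
Proof.
move=> hE le t.
have hB B (s : R) : is_derive s (1 : R) (fun s => E s * expR (B * s))
    ((dE s + B * E s) * expR (B * s)).
  have := is_derive_exp_scaled 1 B s => h1.
  have h2 : is_derive s (1 : R) (fun s => expR (B * s)) (B * expR (B * s)).
    by rewrite mul1r in h1; under eq_fun do rewrite -[expR _]mul1r.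
  by apply: (is_derive_eq (is_derive_mul_fun (hE s) h2)); ring.
have [t0|t0] := leP 0 t.
- have := @derive_ge0_le R (- (fun s => E s * expR (- A * s)))
    (fun s => - ((dE s + - A * E s) * expR (- A * s))) 0 t t0.
  rewrite !fctE mulr0 expR0 mulr1 (ger0_norm t0) => H.
  have {}H : - E 0 <= - (E t * expR (- A * t)).
    apply: H => s _.
    rewrite oppr_ge0 mulr_le0_ge0 ?expR_ge0//.
    by have := le s; rewrite ler_norml => /andP[]; lra.
  rewrite lerN2 in H.
  by rewrite -ler_pdivrMr ?expR_gt0// -expRN -mulNr.
- have := @derive_ge0_le R (fun s => E s * expR (A * s))
    (fun s => (dE s + A * E s) * expR (A * s)) t 0 (ltW t0).
  rewrite mulr0 expR0 mulr1 (ltr0_norm t0) => H.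
  have {}H : E t * expR (A * t) <= E 0.
    apply: H => s _ //.
    rewrite mulr_ge0 ?expR_ge0//.
    by have := le s; rewrite ler_norml => /andP[]; lra.
  by rewrite -ler_pdivrMr ?expR_gt0// -expRN mulrN opprK.
Qed.

(** The intervals of radius [2 B 2^-n] around [u n] are nested, which gives both
    the limit (the supremum of their left ends) and the rate. *)
Lemma geometric_limit (R : realType) (u : nat -> R) (B : R) :
  (forall n, `|u n.+1 - u n| <= B * 2^-1 ^+ n) ->
  exists l, forall n, `|l - u n| <= 2 * B * 2^-1 ^+ n.
Proof.
move=> hu; pose e n : R := 2 * B * 2^-1 ^+ n.
have eS n : e n.+1 = e n - B * 2^-1 ^+ n by rewrite /e exprS; field.
have hu' n := ler_normlP _ _ (hu n).
have aS n m : u n - e n <= u (n + m)%N - e (n + m)%N.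
  elim: m => [|m IH]; first by rewrite addn0.
  by rewrite addnS eS; have [] := hu' (n + m)%N; move: IH; lra.
have bS n m : u (n + m)%N + e (n + m)%N <= u n + e n.
  elim: m => [|m IH]; first by rewrite addn0.
  by rewrite addnS eS; have [] := hu' (n + m)%N; move: IH; lra.
have e0 n : 0 <= e n.
  have : 0 <= B * 2^-1 ^+ n by apply: le_trans (hu n).
  by rewrite /e -mulrA; lra.
have ab n m : u n - e n <= u m + e m.
  apply: le_trans (aS n m) _; apply: le_trans (bS m n); rewrite (addnC m).
  by have := e0 (n + m)%N; lra.
pose S : set R := range (fun n => u n - e n).
have hs : has_sup S.
  split; first by exists (u 0%N - e 0%N), 0%N.
  by exists (u 0%N + e 0%N) => _ [n _ <-].
exists (sup S) => n; rewrite ler_distl; apply/andP; split.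
  by apply: sup_upper_bound => //; exists n.
by apply: ge_sup; [case: hs | move=> _ [m _ <-]].
Qed.

(** * Flows of Lipschitz vector fields *)

Section LipschitzField.
Context {R : realType} {d : nat} (V : 'rV[R]_d -> 'rV[R]_d) (L : R).
Hypothesis L_gt0 : 0 < L.
Hypothesis V_lip : forall x y, `|V x - V y| <= L * `|x - y|.

Lemma lipschitz_field_continuous : continuous V.
Proof.
move=> x; apply: continuous_at_dist => e e0; near=> y.
apply: le_trans (V_lip _ _) _; rewrite -ler_pdivlMl//.
near: y; apply: near_dist_le_row; rewrite mulr_gt0// invr_gt0.
Unshelve. all: by end_near. Qed.

(** Picard iteration. Measured in the weight [exp(2 L |t|)], the integral
    operator halves distances, so the iterates converge on the whole time axis
    without any local construction and gluing. *)
Lemma picard (x0 : 'rV[R]_d) : exists2 c, integral_curve V c & c 0 = x0.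
Proof.
pose A := 2 * L.
have A0 : 0 < A by rewrite mulr_gt0.
have /choice[P hP] : forall f : R -> R, exists F : R -> R, continuous f ->
    F 0 = 0 /\ forall t : R, is_derive t (1 : R) F (f t).
  move=> f; have [cf|ncf] := pselect (continuous f); last by exists f.
  by have [F hF] := antiderivative cf; exists F.
pose step (c : R -> 'rV[R]_d) (t : R) : 'rV[R]_d :=
  x0 + \row_k P (fun s => V (c s) 0 k) t.
have Vc c k : continuous c -> continuous (fun s : R => V (c s) 0 k).
  move=> cc s; apply: (@continuous_comp _ _ _ (V \o c) (fun M => M 0 k)).
    by apply: continuous_comp; [exact: cc | exact: lipschitz_field_continuous].
  exact: coord_continuous.
have step_derive c t : continuous c -> is_derive t (1 : R) (step c) (V (c t)).
  move=> cc; apply/is_derive_rowP => k.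
  have h := (hP _ (Vc c k cc)).2 t.
  have -> : (fun s => step c s 0 k) =
      cst (x0 0 k) + P (fun s => V (c s) 0 k).
    by apply/funext => s; rewrite /step !mxE.
  by apply: is_derive_eq; rewrite add0r.
have step0 c : continuous c -> step c 0 = x0.
  move=> cc; apply/rowP => k; rewrite /step !mxE.
  by rewrite (hP _ (Vc c k cc)).1 addr0.
have step_continuous c : continuous c -> continuous (step c).
  move=> cc; apply: (@is_derive_continuous _ _ _ (V \o c)) => t.
  exact: step_derive.
have contract c c' (C : R) : 0 <= C -> continuous c -> continuous c' ->
    (forall t, `|c t - c' t| <= C * expR (A * `|t|)) ->
    forall t, `|step c t - step c' t| <= C / 2 * expR (A * `|t|).
  move=> C0 cc cc' le t; apply: norm_le_coord => [|k].
    by rewrite mulr_ge0 ?expR_ge0// divr_ge0.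
  pose y s := step c s 0 k - step c' s 0 k.
  have -> : (step c t - step c' t) 0 k = y t by rewrite /y !mxE.
  pose dy s := V (c s) 0 k - V (c' s) 0 k.
  have hy s : is_derive s (1 : R) y (dy s).
    have h1 := (is_derive_rowP _ _ _).1 (step_derive c s cc) k.
    have h2 := (is_derive_rowP _ _ _).1 (step_derive c' s cc') k.
    exact: (is_deriveB h1 h2).
  have := exp_growth_bound (divr_ge0 C0 (ler0n _ 2)) hy.
  have y0 : y 0 = 0 by rewrite /y !step0// subrr.
  move=> /(_ A y0); apply => s.
  rewrite /dy; have /= := le_coord_norm (V (c s) - V (c' s)) k.
  rewrite !mxE => /le_trans; apply; apply: le_trans (V_lip _ _) _.
  have -> : C / 2 * (A * expR (A * `|s|)) = L * (C * expR (A * `|s|)).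
    by rewrite /A; field.
  by rewrite ler_pM2l.
pose u n := iter n step (cst x0).
have uc n : continuous (u n).
  by elim: n => [|n IH]; [move=> x; exact: cvg_cst | exact: step_continuous].
have [C C0 CA] : exists2 C, 0 <= C & C * A = `|V x0|.
  by exists (`|V x0| / A); rewrite ?divfK ?gt_eqF// divr_ge0// ltW.
have u_dist n t : `|u n.+1 t - u n t| <= C * expR (A * `|t|) * 2^-1 ^+ n.
  rewrite mulrAC; elim: n t => [|n IH] t; last first.
    rewrite exprSr mulrA; apply: (contract _ _ _ _ (uc n.+1) (uc n) IH).
    by rewrite mulr_ge0// exprn_ge0.
  apply: norm_le_coord => [|k]; first by rewrite expr0 mulr1 mulr_ge0 ?expR_ge0.
  rewrite expr0 mulr1 /u /= !mxE addrAC subrr add0r.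
  have [P0 dP] := hP _ (Vc (cst x0) k (uc 0%N)).
  apply: (exp_growth_bound C0 dP) => // s /=.
  apply: le_trans (le_coord_norm _ _) _.
  rewrite mulrA CA ler_peMr// -expR0 ler_expR.
  by rewrite mulr_ge0// ltW.
have /choice[w hw] : forall t, exists l : 'rV[R]_d, forall n,
    `|l - u n t| <= 2 * (C * expR (A * `|t|)) * 2^-1 ^+ n.
  move=> t; have hk k : exists l : R, forall n,
      `|l - u n t 0 k| <= 2 * (C * expR (A * `|t|)) * 2^-1 ^+ n.
    apply: geometric_limit => n; apply: le_trans (u_dist n t).
    by have := le_coord_norm (u n.+1 t - u n t) k; rewrite !mxE.
  have /choice[l hl] := hk; exists (\row_k l k) => n.
  apply: norm_le_coord => [|k]; last by rewrite !mxE.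
  by rewrite !mulr_ge0 ?expR_ge0 ?exprn_ge0.
have small (D e : R) : 0 < e -> exists n, D * 2^-1 ^+ n < e.
  move=> e0; have [D0|D0] := leP D 0.
    by exists 0%N; rewrite expr0 mulr1; apply: le_lt_trans e0.
  have : (2^-1 ^+ n : R) @[n --> \oo] --> (0 : R).
    by apply: cvg_expr; rewrite ger0_norm ?invr_ge0// invf_lt1// ltr1n.
  move/(@cvgr_lt _ _ _ _ _ _)/(_ (e / D)) => /(_ (divr_gt0 e0 D0)).
  by case=> N _ /(_ N (leqnn N)) /=; exists N; rewrite mulrC -ltr_pdivlMr.
have wc : continuous w.
  move=> t; apply: continuous_at_dist => e e0.
  pose D := 2 * (C * expR (A * (`|t| + 1))).
  have e3 : 0 < e / 3 by rewrite divr_gt0.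
  have [n hn] := small D _ e3.
  have D_le (s : R) : `|s| <= `|t| + 1 -> `|w s - u n s| <= e / 3.
    move=> st; apply: le_trans (hw s n) _; apply: le_trans _ (ltW hn).
    rewrite /D ler_wpM2r ?exprn_ge0// ler_pM2l// ler_wpM2l//.
    by rewrite ler_expR ler_pM2l.
  near=> s.
  have st : `|s| <= `|t| + 1.
    have -> : s = t - (t - s) by rewrite opprB addrC subrK.
    apply: le_trans (ler_normB _ _) _; rewrite lerD2l.
    by near: s; exact: (@near_dist_le R R t 1 ltr01).
  have us : `|u n t - u n s| <= e / 3.
    near: s; move/(_ t): (uc n) => /cvgrPdist_le; exact.
  have ws := D_le s st.
  have wt : `|w t - u n t| <= e / 3 by apply: D_le; rewrite lerDl.
  have -> : w t - w s = (w t - u n t) + (u n t - u n s) - (w s - u n s).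
    by rewrite opprB !addrA !subrK.
  apply: le_trans (ler_normB _ _) _.
  have := ler_normD (w t - u n t) (u n t - u n s); lra.
have fixw : step w = w.
  apply/funext => t; apply/eqP; rewrite -subr_eq0 -normr_le0.
  apply/ler_addgt0Pr => e e0; rewrite add0r.
  pose D := 2 * (C * expR (A * `|t|)).
  have [n hn] := small (2 * D) e e0; apply: le_trans (ltW hn).
  have h1 := hw t n.+1.
  have C20 : 0 <= 2 * C * 2^-1 ^+ n by rewrite !mulr_ge0// exprn_ge0.
  have h2 := contract w (u n) _ C20 wc (uc n).
  have {}h2 : `|step w t - u n.+1 t| <= D * 2^-1 ^+ n.
    apply: le_trans (h2 _ t) _ => [s|].
      by apply: le_trans (hw s n) _; rewrite mulrA [leRHS]mulrAC.
    have : 0 <= C * expR (A * `|t|) * 2^-1 ^+ n.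
      by rewrite !mulr_ge0 ?expR_ge0// exprn_ge0.
    by rewrite /D; lra.
  have -> : step w t - w t = (step w t - u n.+1 t) - (w t - u n.+1 t).
    by rewrite opprB subrKA.
  apply: le_trans (ler_normB _ _) _; rewrite exprS in h1.
  have : 0 <= D * 2^-1 ^+ n by rewrite /D !mulr_ge0 ?expR_ge0// exprn_ge0.
  by move: h1 h2; rewrite -/D; lra.
exists w => [t|]; last by rewrite -fixw step0.
by rewrite -{1}fixw; exact: step_derive.
Unshelve. all: by end_near. Qed.

(** Gronwall's estimate is applied to the sum of squares of the coordinates,
    which, unlike the sup norm, is differentiable; hence the factors [d]. *)
Lemma integral_curve_dist (c c' : R -> 'rV[R]_d) t :
  integral_curve V c -> integral_curve V c' ->
  `|c t - c' t| ^+ 2 <=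
    d%:R * expR (2 * d%:R * L * `|t|) * `|c 0 - c' 0| ^+ 2.
Proof.
move=> hc hc'.
pose e s k := c s 0 k - c' s 0 k.
pose de s k := V (c s) 0 k - V (c' s) 0 k.
have he s k : is_derive s (1 : R) (fun r => e r k) (de s k).
  have h1 := (is_derive_rowP _ _ _).1 (hc s) k.
  have h2 := (is_derive_rowP _ _ _).1 (hc' s) k.
  exact: (is_deriveB h1 h2).
pose E s := \sum_k e s k * e s k.
pose dE s := \sum_k (de s k * e s k + e s k * de s k).
have hE s : is_derive s (1 : R) E (dE s).
  by apply: is_derive_sum_fun => k; apply: is_derive_mul_fun.
have normE s : `|c s - c' s| ^+ 2 <= E s.
  case: (pselect (c s - c' s = 0)) => [->|/eqP].
    by rewrite normr0 expr0n /= sumr_ge0// => k _; rewrite -expr2 sqr_ge0.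
  rewrite -normr_eq0 => /mx_norm_neq0[[i k] /=]; rewrite ord1 => h.
  have -> : `|c s - c' s| = `|(c s - c' s) 0 k| by exact: h.
  rewrite /E (bigD1 k)//= !mxE -/(e s k) real_normK ?num_real// expr2 lerDl.
  by rewrite sumr_ge0// => l _; rewrite -expr2 sqr_ge0.
have e_le s k : `|e s k| <= `|c s - c' s|.
  by have := le_coord_norm (c s - c' s) k; rewrite !mxE.
have de_le s k : `|de s k| <= L * `|c s - c' s|.
  have := le_coord_norm (V (c s) - V (c' s)) k; rewrite !mxE => /le_trans.
  by apply; exact: V_lip.
have dE_le s : `|dE s| <= (2 * d%:R * L) * E s.
  apply: le_trans (_ : d%:R * (2 * L * `|c s - c' s| ^+ 2) <= _); last first.
    have -> : 2 * d%:R * L * E s = d%:R * (2 * L * E s) by ring.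
    by rewrite ler_wpM2l// ler_pM2l ?mulr_gt0.
  apply: le_trans (ler_norm_sum _ _ _) _.
  rewrite -[X in X%:R * _]card_ord mulr_natl -sumr_const.
  apply: ler_sum => k _; apply: le_trans (ler_normD _ _) _; rewrite !normrM.
  have := ler_pM (normr_ge0 _) (normr_ge0 _) (de_le s k) (e_le s k).
  by rewrite expr2; lra.
apply: le_trans (normE t) _; apply: le_trans (gronwall hE dE_le t) _.
rewrite [leRHS]mulrAC ler_wpM2r ?expR_ge0//.
rewrite -[X in X%:R * _]card_ord mulr_natl -sumr_const.
apply: ler_sum => k _; rewrite -expr2 -real_normK ?num_real//.
by rewrite ler_sqr ?nnegrE.
Qed.

Lemma lipschitz_flow : exists Phi, is_flow V Phi.
Proof.
have /choice[Phi hPhi] : forall x, exists c : R -> 'rV[R]_d,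
    integral_curve V c /\ c 0 = x.
  by move=> x; have [c] := picard x; exists c.
exists Phi => x; have [hx x0] := hPhi x; split => // c hc c0 t.
have := integral_curve_dist t hc hx.
rewrite c0 x0 subrr normr0 expr0n mulr0 => H; apply/eqP.
by rewrite -subr_eq0 -normr_eq0 -sqrf_eq0 eq_le H sqr_ge0.
Qed.

End LipschitzField.

Lemma flow_add (R : realType) (d : nat) (V : 'rV[R]_d -> 'rV[R]_d) Phi x s t :
  is_flow V Phi -> Phi (Phi x s) t = Phi x (s + t).
Proof.
move=> hPhi; have [_ hx _] := hPhi x; have [_ _ u] := hPhi (Phi x s).
rewrite -(u (fun r => Phi x (s + r))) ?addr0// => r.
apply/is_derive_rowP => k.
have h1 := (is_derive_rowP _ _ _).1 (hx (s + r)) k.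
have h2 : is_derive r (1 : R) (fun r => s + r) 1.
  have -> : (fun r => s + r) = cst s + id by apply/funext.
  by apply: is_derive_eq; rewrite add0r.
by have := is_derive1_comp h1 h2; rewrite mulr1.
Qed.

Lemma lipschitz_flow_continuous (R : realType) (d : nat)
    (V : 'rV[R]_d -> 'rV[R]_d) (L : R) Phi t : 0 < L ->
  (forall x y, `|V x - V y| <= L * `|x - y|) -> is_flow V Phi ->
  continuous (fun x => Phi x t).
Proof.
move=> L0 lip hPhi x; apply: continuous_at_dist => e e0.
pose K : R := d%:R * expR (2 * d%:R * L * `|t|) + 1.
have K0 : 0 < K by rewrite ltr_wpDl// mulr_ge0// expR_ge0.
have r0 : 0 < e ^+ 2 / K by rewrite divr_gt0// exprn_gt0.
near=> y.
have [x0 hx _] := hPhi x; have [y0 hy _] := hPhi y.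
have := integral_curve_dist L0 lip t hx hy; rewrite x0 y0 => H.
rewrite -(ler_sqr (normr_ge0 _) (ltW e0)).
apply: le_trans H _; apply: le_trans (_ : K * `|x - y| ^+ 2 <= _).
  by rewrite ler_wpM2r ?sqr_ge0// lerDl.
rewrite mulrC -ler_pdivlMr//.
have : `|x - y| <= Num.min 1 (e ^+ 2 / K).
  by near: y; apply: near_dist_le_row; rewrite lt_min ltr01.
rewrite le_min => /andP[xy1 xy]; apply: le_trans xy.
by rewrite expr2 ler_piMl.
Unshelve. all: by end_near. Qed.

(** * Lebesgue outer measure of sets of points *)

Section OuterMeasure.
Context {R : realType} {d : nat}.
Hypothesis d_gt0 : (0 < d)%N.
Local Notation point := 'rV[R]_d.
Implicit Types (A : set point) (B C : point * point).

Definition side B (k : 'I_d) : R := B.2 0 k - B.1 0 k.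
Definition proper_box B : Prop := forall k, B.1 0 k <= B.2 0 k.

Lemma side_ge0 B k : proper_box B -> 0 <= side B k.
Proof. by move=> /(_ k); rewrite subr_ge0. Qed.

Lemma box_volume_ge0 B : proper_box B -> 0 <= box_volume B.
Proof. by move=> hB; apply: prodr_ge0 => k _; exact: side_ge0. Qed.

Lemma lebesgue_outer_ge0 A : (0 <= lebesgue_outer A)%E.
Proof.
apply/ereal_infP => _ [B [hB _] <-]; apply: nneseries_ge0 => l _ _.
by rewrite lee_fin box_volume_ge0// => k; exact: hB.
Qed.

Lemma le_lebesgue_outer A A' : A `<=` A' ->
  (lebesgue_outer A <= lebesgue_outer A')%E.
Proof.
move=> AA'; apply: le_ereal_inf => _ [B [hB cB] <-]; exists B => //.
by split => //; exact: subset_trans cB.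
Qed.

Lemma lebesgue_outer_le_pairs A (B : nat -> nat -> point * point) :
  (forall l l', proper_box (B l l')) ->
  A `<=` \bigcup_l \bigcup_l' box (B l l') ->
  (lebesgue_outer A <=
    \sum_(0 <= l <oo) \sum_(0 <= l' <oo) (box_volume (B l l'))%:E)%E.
Proof.
move=> hB cB.
have vol0 l l' : (0 <= (box_volume (B l l'))%:E)%E by rewrite lee_fin box_volume_ge0.
have /card_esym/ppcard_eqP[f] := card_nat2.
apply: (@le_trans _ _ (\sum_(0 <= i <oo)
    (box_volume (B (f i).1 (f i).2))%:E)%E).
  apply: ereal_inf_lbound; exists (fun i => B (f i).1 (f i).2) => //.
  split=> [i k|x /cB[l _ [l' _ xB]]]; first exact: hB.
  by exists (f^-1%FUN (l, l')) => //=; rewrite invK ?inE.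
rewrite nneseries_esum// set_true.
have bf : set_bij setT setT f by exact: bij.
rewrite -(@reindex_esum _ _ _ setT setT f
  (fun i => (box_volume (B i.1 i.2))%:E))//.
rewrite (eq_eseriesr (fun l _ => nneseries_esum (fun l' _ => vol0 l l'))).
rewrite nneseries_esum ?set_true; last by move=> *; exact: esum_ge0.
rewrite esum_esum// (_ : _ `*`` _ = setT)//.
by apply/seteqP; split.
Qed.

Lemma lebesgue_outer_cover A (e : R) : 0 < e -> lebesgue_outer A \is a fin_num ->
  exists B : nat -> point * point, [/\ forall l, proper_box (B l),
    A `<=` \bigcup_l box (B l) &
    (\sum_(0 <= l <oo) (box_volume (B l))%:E < lebesgue_outer A + e%:E)%E].
Proof.
move=> e0 /(lb_ereal_inf_adherent e0)[_ [B [hB cB] <-] lt].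
by exists B; split.
Qed.

Lemma lebesgue_outer_bigcup (A : nat -> set point) :
  (lebesgue_outer (\bigcup_n A n) <= \sum_(0 <= n <oo) lebesgue_outer (A n))%E.
Proof.
have [[i ioo]|Afin] := pselect (exists i, lebesgue_outer (A i) = +oo%E).
  rewrite (eseries_pinfty _ _ ioo) ?leey// => n _.
  by rewrite -ltNye (lt_le_trans _ (lebesgue_outer_ge0 _)).
apply/lee_addgt0Pr => e e0.
apply: le_trans (epsilon_trick _ (fun n => lebesgue_outer_ge0 (A n)) (ltW e0)).
have /choice[B hB] : forall n, exists B : nat -> point * point,
    [/\ forall l, proper_box (B l), A n `<=` \bigcup_l box (B l) &
    (\sum_(0 <= l <oo) (box_volume (B l))%:E <=
      lebesgue_outer (A n) + (e / (2 ^ n.+1)%:R)%:E)%E].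
  move=> n; have en : 0 < e / (2 ^ n.+1)%:R by rewrite divr_gt0// ltr0n expn_gt0.
  have := @lebesgue_outer_cover (A n) _ en.
  rewrite ge0_fin_numE ?lebesgue_outer_ge0// ltey.
  have -> : lebesgue_outer (A n) != +oo%E by apply/eqP => h; apply: Afin; exists n.
  by case=> // B [h1 h2 /ltW h3]; exists B; split.
apply: le_trans (@lebesgue_outer_le_pairs _ B _ _) _.
- by move=> l; have [] := hB l.
- by move=> x [n _]; have [_ + _] := hB n; move/[apply] => ?; exists n.
- apply: lee_nneseries => [n _ _|n _]; last by have [] := hB n.
  by apply: nneseries_ge0 => l _ _; have [h _ _] := hB n; rewrite lee_fin box_volume_ge0.
Qed.

Lemma box_volume0 : box_volume ((0, 0) : point * point) = 0.
Proof.
rewrite /box_volume (bigD1 (Ordinal d_gt0))//= !mxE.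
by rewrite subrr mul0r.
Qed.

Lemma lebesgue_outer_box B : proper_box B ->
  (lebesgue_outer (box B) <= (box_volume B)%:E)%E.
Proof.
move=> hB; apply: ereal_inf_lbound.
exists (fun l => if (l == 0)%N then B else (0, 0)).
  by split=> [[|l] k|x xB]; [exact: hB | rewrite !mxE | exists 0%N].
rewrite (nneseries_split 0 1) => [|[|l] _]; last 2 first.
- by rewrite lee_fin box_volume_ge0.
- by rewrite box_volume0.
rewrite add0n big_nat1 eseries0 ?adde0// => -[//|l] _ _.
by rewrite box_volume0.
Qed.

Lemma lebesgue_outer_set0 : lebesgue_outer (set0 : set point) = 0%E.
Proof.
apply/eqP; rewrite eq_le lebesgue_outer_ge0 andbT.
have := @lebesgue_outer_box (0, 0); rewrite box_volume0 => h.
apply: le_trans (h _) => [|k]; last by rewrite !mxE.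
exact: le_lebesgue_outer.
Qed.

Lemma lebesgue_outerU A A' :
  (lebesgue_outer (A `|` A') <= lebesgue_outer A + lebesgue_outer A')%E.
Proof.
pose F n := if n is 0%N then A else if n is 1%N then A' else set0.
apply: (@le_trans _ _ (\sum_(0 <= n <oo) lebesgue_outer (F n))%E).
  apply: le_trans (lebesgue_outer_bigcup F); apply: le_lebesgue_outer.
  by move=> x [xA|xA']; [exists 0%N | exists 1%N].
rewrite (nneseries_split 0 2) => [|n _]; last exact: lebesgue_outer_ge0.
rewrite add0n big_ltn// big_nat1 eseries0 ?adde0// => -[//|[//|l]] _ _.
exact: lebesgue_outer_set0.
Qed.

Lemma lebesgue_outer_bigcup0 (A : nat -> set point) :
  (forall n, lebesgue_outer (A n) = 0%E) ->
  lebesgue_outer (\bigcup_n A n) = 0%E.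
Proof.
move=> A0; apply/eqP; rewrite eq_le lebesgue_outer_ge0 andbT.
by apply: le_trans (lebesgue_outer_bigcup A) _; rewrite eseries0.
Qed.

Lemma lebesgue_outer_sub0 A A' : A `<=` A' -> lebesgue_outer A' = 0%E ->
  lebesgue_outer A = 0%E.
Proof.
move=> AA' A'0; apply/eqP; rewrite eq_le lebesgue_outer_ge0 andbT -A'0.
exact: le_lebesgue_outer.
Qed.

(** The universal property behind all the comparisons below: among the monotone
    and countably subadditive set functions with given bound on boxes, the outer
    measure is the largest. *)
Lemma lebesgue_outer_dominates (Psi : set point -> \bar R) (c : R) : 0 < c ->
  (forall A, 0 <= Psi A)%E ->
  (forall A A', A `<=` A' -> Psi A <= Psi A')%E ->
  (forall A : nat -> set point, Psi (\bigcup_n A n) <= \sum_(0 <= n <oo) Psi (A n))%E ->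
  (forall B, proper_box B -> Psi (box B) <= (c * box_volume B)%:E)%E ->
  forall A, (Psi A <= c%:E * lebesgue_outer A)%E.
Proof.
move=> c0 Psi0 mono sub hbox A.
have [Aoo|] := eqVneq (lebesgue_outer A) +oo%E; last first.
  rewrite -ltey -ge0_fin_numE ?lebesgue_outer_ge0// => Afin.
  apply/lee_addgt0Pr => e e0.
  have e'0 : 0 < e / (c + 1) by rewrite divr_gt0// addr_gt0.
  have [B [hB cB lt]] := lebesgue_outer_cover e'0 Afin.
  apply: le_trans (mono _ _ cB) _; apply: le_trans (sub _) _.
  apply: (@le_trans _ _ (\sum_(0 <= l <oo) (c%:E * (box_volume (B l))%:E))%E).
    by apply: lee_nneseries => [l _ _|l _]; rewrite ?Psi0// -EFinM hbox.
  rewrite nneseriesZl => [|l _]; last by rewrite lee_fin box_volume_ge0.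
  apply: le_trans (_ : c%:E * (lebesgue_outer A + (e / (c + 1))%:E) <= _)%E.
    by rewrite lee_pmul2l ?ltW.
  rewrite muleDr ?fin_num_adde_defl// leeD2l// -EFinM lee_fin.
  rewrite mulrCA ler_piMr//; first exact: ltW.
  by rewrite ler_pdivrMr ?mul1r ?lerDl// ltr_wpDl// ltW.
by rewrite Aoo gt0_muley ?lte_fin// leey.
Qed.

Definition midpoint B k : R := (B.1 0 k + B.2 0 k) / 2.
Definition set_coord (x : point) k (v : R) : point :=
  \row_j if j == k then v else x 0 j.
Definition lower_half B k := (B.1, set_coord B.2 k (midpoint B k)).
Definition upper_half B k := (set_coord B.1 k (midpoint B k), B.2).

Lemma proper_halves B k : proper_box B ->
  proper_box (lower_half B k) /\ proper_box (upper_half B k).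
Proof.
by move=> hB; split=> j; have := hB j; rewrite /= mxE /midpoint;
  case: eqP => // ->; lra.
Qed.

Lemma side_halves B k j :
  side (lower_half B k) j = (if j == k then side B j / 2 else side B j) /\
  side (upper_half B k) j = (if j == k then side B j / 2 else side B j).
Proof.
by split; rewrite /side /= mxE /midpoint; case: eqP => // ->; field.
Qed.

Lemma box_volumeE B : box_volume B = \prod_k side B k.
Proof. by []. Qed.

Lemma box_volume_halves B k :
  box_volume (lower_half B k) + box_volume (upper_half B k) = box_volume B.
Proof.
rewrite !box_volumeE !(bigD1 (P := predT) k)//=.
have [-> ->] := side_halves B k k; rewrite eqxx.
under eq_bigr => j /negbTE jk do rewrite (side_halves B k j).1 jk.
under [in X in _ + X]eq_bigr => j /negbTE jk do rewrite (side_halves B k j).2 jk.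
by field.
Qed.

Lemma box_halves B k : box B `<=` box (lower_half B k) `|` box (upper_half B k).
Proof.
move=> x xB; have [xm|xm] := leP (x 0 k) (midpoint B k); [left|right] => j /=.
- by rewrite mxE; have := xB j; case: eqP => [->|]//; rewrite xm => /andP[->].
- rewrite mxE; have := xB j; case: eqP => [->|]//.
  by rewrite (ltW xm) => /andP[_ ->].
Qed.

(** Induction on boxes: repeated halving makes every side of a box in the
    chosen directions as short as desired. *)
Lemma box_bisection (P : point * point -> Prop) (s : seq 'I_d) (e : R) : 0 < e ->
  (forall C, proper_box C -> (forall k, k \in s -> side C k <= e) -> P C) ->
  (forall C k, proper_box C -> k \in s ->
     P (lower_half C k) -> P (upper_half C k) -> P C) ->
  forall B, proper_box B -> P B.
Proof.
move=> e0; elim: s => [|k s IH] small halves B pB; first exact: small.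
apply: IH => // [C pC sC|C j pC js]; last by apply: halves; rewrite // inE js orbT.
have [m] : exists m : nat, side C k <= e * 2 ^+ m.
  exists (Num.truncn (side C k / e)).+1.
  rewrite mulrC -ler_pdivrMr//; apply: ltW; apply: lt_le_trans (truncnS_gt _) _.
  by rewrite -natrX ler_nat ltnW// ltn_expl.
elim: m C pC sC => [|m IHm] C pC sC Ck.
  apply: small => // j; rewrite inE => /orP[/eqP->|]; last exact: sC.
  by rewrite expr0 mulr1 in Ck.
have [pl pu] := proper_halves k pC.
have half_le j : side C j / 2 <= side C j by have := side_ge0 j pC; lra.
have Ck2 : side C k / 2 <= e * 2 ^+ m.
  by rewrite ler_pdivrMr// -mulrA -exprSr.
apply: (halves C k) => //; first by rewrite mem_head.
- apply: IHm => // [j js|]; rewrite (side_halves _ _ _).1 ?eqxx//.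
  by case: ifP => // _; [apply: le_trans (half_le _) _|]; exact: sC.
- apply: IHm => // [j js|]; rewrite (side_halves _ _ _).2 ?eqxx//.
  by case: ifP => // _; [apply: le_trans (half_le _) _|]; exact: sC.
Qed.

(** A box with sides at most [e / 2] meets at most one of the two sets, so it is
    paid for only once; other boxes are halved until they are that small. *)
Lemma lebesgue_outer_separated A A' (e : R) : 0 < e ->
  (forall x y, A x -> A' y -> e <= `|x - y|) ->
  (lebesgue_outer A + lebesgue_outer A' <= lebesgue_outer (A `|` A'))%E.
Proof.
move=> e0 sep.
pose Psi X := (lebesgue_outer (X `&` A) + lebesgue_outer (X `&` A'))%E.
have -> : (lebesgue_outer A + lebesgue_outer A' = Psi (A `|` A'))%E.
  by rewrite /Psi setUK (setUC A) setUK.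
rewrite -[leRHS]mul1e; apply: (lebesgue_outer_dominates ltr01).
- by move=> X; rewrite adde_ge0// lebesgue_outer_ge0.
- by move=> X Y XY; apply: leeD; apply: le_lebesgue_outer; exact: setSI.
- move=> X; rewrite nneseriesD; try by move=> *; exact: lebesgue_outer_ge0.
  by rewrite /Psi !setI_bigcupl; apply: leeD; exact: lebesgue_outer_bigcup.
- move=> B pB; rewrite mul1r; move: B pB.
  apply: (@box_bisection _ (enum 'I_d) (e / 2)); first by rewrite divr_gt0.
    rewrite /Psi => C pC sC.
    have close x y : box C x -> box C y -> `|x - y| <= e / 2.
      move=> xC yC; apply: norm_le_coord => [|k]; first by rewrite ltW ?divr_gt0.
      have := sC k (mem_enum _ _); rewrite /side.
      rewrite !mxE ler_norml; have /andP[] := xC k; have /andP[] := yC k.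
      by move=> *; apply/andP; split; lra.
    have [[x [xC xA]]|noA] := pselect (exists x, (box C `&` A) x).
      have -> : box C `&` A' = set0.
        apply/seteqP; split=> // y [yC yA']; have := sep _ _ xA yA'.
        by have := close _ _ xC yC; lra.
      rewrite lebesgue_outer_set0 adde0; apply: le_trans (lebesgue_outer_box pC).
      by apply: le_lebesgue_outer => y [].
    have -> : box C `&` A = set0.
      by apply/seteqP; split=> // y yCA; apply: noA; exists y.
    rewrite lebesgue_outer_set0 add0e; apply: le_trans (lebesgue_outer_box pC).
    by apply: le_lebesgue_outer => y [].
  move=> C k pC _ lo up; rewrite -(box_volume_halves C k) EFinD.
  apply: le_trans (leeD lo up); rewrite addeACA.
  by apply: leeD; (apply: le_trans (lebesgue_outerU _ _); apply: le_lebesgue_outer;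
    rewrite -setIUl; apply: setSI; exact: box_halves).
Qed.

End OuterMeasure.

(** * Shears, coordinatewise maps and compact sets *)

Section Shears.
Context {R : realType} {d : nat}.
Hypothesis d_gt0 : (0 < d)%N.
Local Notation point := 'rV[R]_d.
Implicit Types (A : set point) (B C : point * point).

Lemma lebesgue_outer_image (T : point -> point) (c : R) : 0 < c ->
  (forall B, proper_box B ->
     lebesgue_outer (T @` box B) <= (c * box_volume B)%:E)%E ->
  forall A, (lebesgue_outer (T @` A) <= c%:E * lebesgue_outer A)%E.
Proof.
move=> c0 hT; apply: (lebesgue_outer_dominates c0) => //.
- by move=> A; exact: lebesgue_outer_ge0.
- by move=> A A' AA'; apply: le_lebesgue_outer; exact: image_subset.
- move=> A; rewrite image_bigcup; exact: lebesgue_outer_bigcup.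
Qed.

Definition shear (k : 'I_d) (b : point -> R) (x : point) : point :=
  x + b x *: delta_mx 0 k.

Lemma shearE k b x j : shear k b x 0 j = if j == k then x 0 j + b x else x 0 j.
Proof. by rewrite !mxE /= eq_sym; case: eqP => _; rewrite ?mulr1 ?mulr0 ?addr0. Qed.

Section OneShear.
Variables (k : 'I_d) (b : point -> R) (L : R).
Hypothesis L_gt0 : 0 < L.
Hypothesis b_lip : forall x y, `|b x - b y| <= L * `|x - y|.
Hypothesis b_indep : forall x v, b (set_coord x k v) = b x.

(** On a box that is thin in the directions other than [k], the amount of the
    shear is nearly constant, so that the image fits into a translate whose
    [k]-th side is only slightly longer; a general box is cut into thin ones. *)
Lemma lebesgue_outer_shear_le A :
  (lebesgue_outer (shear k b @` A) <= lebesgue_outer A)%E.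
Proof.
rewrite -[leRHS]mul1e; apply: lebesgue_outer_image => // B pB.
rewrite mul1r; pose base C := \prod_(j | j != k) side C j.
have base0 C : proper_box C -> 0 <= base C.
  by move=> pC; apply: prodr_ge0 => j _; exact: side_ge0.
apply/lee_addgt0Pr => e e0.
pose eta := e / (base B + 1).
have eta0 : 0 < eta by rewrite divr_gt0// ltr_wpDl// base0.
pose W C := (side C k + eta) * base C.
apply: (@le_trans _ _ (W B)%:E); last first.
  rewrite -EFinD lee_fin /W mulrDl box_volumeE [X in _ <= X + _](bigD1 k)//=.
  rewrite lerD2l /eta mulrAC ler_pdivrMr ?ltr_wpDl ?base0//.
  by rewrite ler_pM2l// lerDl.
clearbody eta; rewrite /W {W}; move: B pB.
apply: (@box_bisection _ _ _ [seq j <- enum 'I_d | j != k] (eta / (2 * L))).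
- by rewrite divr_gt0// mulr_gt0.
- move=> C pC sC; pose r := eta / 2.
  (* [C'] is [C] translated by [b C.1] and thickened by [eta / 2] at both ends. *)
  pose C' := (C.1 + (b C.1 - r) *: delta_mx 0 k, C.2 + (b C.1 + r) *: delta_mx 0 k).
  have C'E j : C'.1 0 j = (if j == k then C.1 0 j + (b C.1 - r) else C.1 0 j) /\
      C'.2 0 j = (if j == k then C.2 0 j + (b C.1 + r) else C.2 0 j).
    by rewrite /C' !mxE /= eq_sym; case: eqP => _; rewrite ?mulr1 ?mulr0 ?addr0.
  have sideC' j : side C' j = if j == k then side C j + eta else side C j.
    by rewrite /side (C'E j).1 (C'E j).2; case: eqP => // _; rewrite /r; field.
  have pC' : proper_box C'.
    move=> j; rewrite -subr_ge0 -[leRHS]/(side C' j) sideC'.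
    have := side_ge0 j pC; case: eqP => // _ h; exact: addr_ge0 (ltW _).
  have -> : (side C k + eta) * base C = box_volume C'.
    rewrite box_volumeE (bigD1 k)//= sideC' eqxx; congr (_ * _).
    by apply: eq_bigr => j /negbTE jk; rewrite sideC' jk.
  apply: le_trans (lebesgue_outer_box d_gt0 pC').
  apply: le_lebesgue_outer => _ [x xC <-] j.
  rewrite shearE (C'E j).1 (C'E j).2; have := xC j; case: eqP => // -> xk.
  have bx : `|b x - b C.1| <= r.
    rewrite -(b_indep x (C.1 0 k)); apply: le_trans (b_lip _ _) _.
    rewrite -ler_pdivlMl//; apply: norm_le_coord => [|i].
      by rewrite mulr_ge0 ?invr_ge0 ?(ltW L_gt0)// divr_ge0// ltW.
    rewrite !mxE; case: eqP => [->|/eqP ik].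
      by rewrite subrr normr0 mulr_ge0 ?invr_ge0 ?(ltW L_gt0)// divr_ge0// ltW.
    have := sC i; rewrite mem_filter ik mem_enum => /(_ isT).
    have -> : eta / (2 * L) = L^-1 * r by rewrite /r; field; rewrite gt_eqF.
    apply: le_trans; have /andP[x1 x2] := xC i.
    by rewrite ger0_norm ?subr_ge0// lerD2r.
  by move: bx; rewrite ler_norml => /andP[? ?]; apply/andP; split; lra.
- move=> C j pC; rewrite mem_filter => /andP[jk _] lo up.
  have -> : (side C k + eta) * base C =
      (side (lower_half C j) k + eta) * base (lower_half C j) +
      (side (upper_half C j) k + eta) * base (upper_half C j).
    rewrite (side_halves C j k).1 (side_halves C j k).2 eq_sym (negbTE jk).
    rewrite -mulrDr; congr (_ * _); rewrite /base !(bigD1 (P := predC1 k) j)//=.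
    rewrite (side_halves C j j).1 (side_halves C j j).2 eqxx.
    under [in X in _ = X + _]eq_bigr => i /andP[_ /negbTE ij] do
      rewrite (side_halves C j i).1 ij.
    under [in X in _ = _ + X]eq_bigr => i /andP[_ /negbTE ij] do
      rewrite (side_halves C j i).2 ij.
    by field.
  rewrite EFinD; apply: le_trans (leeD lo up).
  apply: le_trans (lebesgue_outerU d_gt0 _ _); apply: le_lebesgue_outer.
  by rewrite -image_setU; apply: image_subset; exact: box_halves.
Qed.

End OneShear.

(** The amount of a shear is not changed by the shear itself, so that the shear by
    the opposite amount is its inverse. *)
Lemma lebesgue_outer_le_shear k b L A : 0 < L ->
  (forall x y, `|b x - b y| <= L * `|x - y|) ->
  (forall x v, b (set_coord x k v) = b x) ->
  (lebesgue_outer A <= lebesgue_outer (shear k b @` A))%E.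
Proof.
move=> L0 b_lip b_indep; pose b' x := - b x.
have b'_lip x y : `|b' x - b' y| <= L * `|x - y|.
  by rewrite /b' -opprD normrN.
have b'_indep x v : b' (set_coord x k v) = b' x by rewrite /b' b_indep.
have bS x : b (shear k b x) = b x.
  rewrite -(b_indep x (x 0 k + b x)); congr b; apply/rowP => j.
  by rewrite shearE mxE; case: eqP => // ->.
apply: le_trans (lebesgue_outer_shear_le L0 b'_lip b'_indep (shear k b @` A)).
apply: le_lebesgue_outer => x xA; exists (shear k b x); first by exists x.
apply/rowP => j; rewrite shearE /b' bS shearE.
by case: eqP => // _; rewrite addrK.
Qed.

(** A map that acts on each coordinate separately sends boxes into boxes, and
    hence null sets to null sets as soon as it is Lipschitz. *)
Lemma lebesgue_outer_coordinatewise (h : 'I_d -> R -> R) (L : R) A : 0 < L ->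
  (forall k s t, `|h k s - h k t| <= L * `|s - t|) ->
  lebesgue_outer A = 0%E ->
  lebesgue_outer ((fun x : point => \row_k h k (x 0 k)) @` A) = 0%E.
Proof.
move=> L0 h_lip A0; apply/eqP; rewrite eq_le lebesgue_outer_ge0 andbT.
rewrite -(mule0 (L ^+ d)%:E) -A0; apply: lebesgue_outer_image.
  by rewrite exprn_gt0.
move=> B pB; pose m k := (B.1 0 k + B.2 0 k) / 2.
pose B' : point * point := (\row_k (h k (m k) - L * (side B k / 2)),
                            \row_k (h k (m k) + L * (side B k / 2))).
have sideB' k : side B' k = L * side B k by rewrite /side !mxE /side; field.
have pB' : proper_box B'.
  move=> k; rewrite -subr_ge0 -[leRHS]/(side B' k) sideB'.
  by rewrite mulr_ge0 ?(ltW L0)// side_ge0.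
have -> : L ^+ d * box_volume B = box_volume B'.
  rewrite !box_volumeE (eq_bigr _ (fun k _ => sideB' k)) big_split /=.
  by rewrite prodr_const card_ord.
apply: le_trans (lebesgue_outer_box d_gt0 pB').
apply: le_lebesgue_outer => _ [x xB <-] k; rewrite !mxE -ler_distl.
apply: le_trans (h_lip k _ _) _; rewrite ler_pM2l// ler_distl /side /m.
by have /andP[? ?] := xB k; apply/andP; split; lra.
Qed.

Lemma enlarge_box B (e : R) : 0 < e -> proper_box B ->
  exists2 r, 0 < r &
    box_volume (B.1 - const_mx r, B.2 + const_mx r) <= box_volume B + e.
Proof.
move=> e0 pB; pose P : {poly R} := \prod_k ('X + (side B k)%:P).
have PE y : P.[y] = \prod_k (y + side B k).
  by rewrite horner_prod; apply: eq_bigr => k _; rewrite !hornerE.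
have /cvgrPdist_le/(_ _ e0)[r /= r0 hr] := @continuous_horner R P 0.
exists (r / 4); first by rewrite divr_gt0.
have := hr (r / 2) _; rewrite /= sub0r normrN gtr0_norm ?divr_gt0//.
move=> /(_ ltac:(lra)); rewrite !PE.
under eq_bigr do rewrite add0r.
rewrite -box_volumeE ler_norml => /andP[h _].
rewrite box_volumeE; suff -> : \prod_k side (B.1 - const_mx (r / 4),
    B.2 + const_mx (r / 4)) k = \prod_k (r / 2 + side B k) by lra.
by apply: eq_bigr => k _; rewrite /side !mxE; field.
Qed.

(** In an almost optimal cover the [l]-th box can be enlarged to a neighbourhood
    of itself at the cost of [2^-l] times the remaining margin. *)
Lemma lebesgue_outer_open A (r : R) : (lebesgue_outer A < r%:E)%E ->
  exists O, [/\ open O, A `<=` O & (lebesgue_outer O <= r%:E)%E].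
Proof.
move=> Ar; have Afin : lebesgue_outer A \is a fin_num.
  by rewrite ge0_fin_numE ?lebesgue_outer_ge0// (lt_trans Ar)// ltry.
pose a := fine (lebesgue_outer A); have aE : lebesgue_outer A = a%:E by rewrite fineK.
have e0 : 0 < (r - a) / 2.
  by move: Ar; rewrite aE lte_fin => ?; rewrite divr_gt0// subr_gt0.
have [B [pB AB lt]] := lebesgue_outer_cover e0 Afin.
have /choice[t ht] : forall l, exists r', 0 < r' /\
    box_volume ((B l).1 - const_mx r', (B l).2 + const_mx r') <=
    box_volume (B l) + (r - a) / 2 / (2 ^ l.+1)%:R.
  move=> l; have el : 0 < (r - a) / 2 / (2 ^ l.+1)%:R.
    by rewrite divr_gt0// ltr0n expn_gt0.
  by have [r' ? ?] := enlarge_box el (pB l); exists r'.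
pose B' l := ((B l).1 - const_mx (t l), (B l).2 + const_mx (t l)).
have pB' l : proper_box (B' l).
  by move=> k; rewrite !mxE; have := pB l k; have [] := ht l; lra.
exists (\bigcup_l \bigcup_(x in box (B l)) ball x (t l)); split.
- apply: bigcup_open => l _; apply: bigcup_open => x _.
  exact: (@ball_open R 'rV[R]_d x).
- by move=> x /AB[l _ xB]; exists l => //; exists x => //; apply: ballxx; exact: (ht l).1.
- apply: (@le_trans _ _ (\sum_(0 <= l <oo) lebesgue_outer (box (B' l)))%E).
    apply: le_trans (lebesgue_outer_bigcup _); apply: le_lebesgue_outer.
    move=> y [l _ [x xB]]; rewrite -ball_normE /= => xy; exists l => // k.
    have := le_trans (le_coord_norm (x - y) k) (ltW xy).
    rewrite /B' /= !mxE ler_distl => /andP[? ?]; have /andP[? ?] := xB k.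
    by apply/andP; split; lra.
  apply: (@le_trans _ _ (\sum_(0 <= l <oo) ((box_volume (B l))%:E +
      ((r - a) / 2 / (2 ^ l.+1)%:R)%:E))%E).
    apply: lee_nneseries => [l _ _|l _]; first exact: lebesgue_outer_ge0.
    apply: le_trans (lebesgue_outer_box d_gt0 (pB' l)) _.
    by rewrite -EFinD lee_fin; have [] := ht l.
  apply: le_trans (epsilon_trick _ _ (ltW e0)) _.
    by move=> l; rewrite lee_fin box_volume_ge0.
  apply: le_trans (leeD2r _ (ltW lt)) _.
  by rewrite aE -!EFinD lee_fin; lra.
Qed.

Lemma compact_open_margin (K O : set point) : compact K -> open O -> K `<=` O ->
  exists2 r, 0 < r & forall x y, K x -> `|x - y| < r -> O y.
Proof.
move=> cK oO KO; have := (compact_near_coveringP K).1 cK.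
move=> /(_ R (0^'+) (fun r x => forall y, `|x - y| < r -> O y) _).
case=> [x Kx|r /= r0 hr]; last first.
  exists (r / 2); first by rewrite divr_gt0.
  move=> x y Kx; apply: (hr (r / 2)) => //=.
    by rewrite sub0r normrN gtr0_norm ?divr_gt0//; lra.
  by rewrite divr_gt0.
have /(open_nbhs_nbhs)/nbhs_ballP[e /= e0 he] : open_nbhs x O by split=> //; exact: KO.
exists (ball x (e / 2), [set r | 0 < r < e / 2]) => /=.
  split; first exact: nbhsx_ballx (divr_gt0 _ _).
  near=> r; apply/andP; split; near: r; [exact: nbhs_right_gt|].
  by apply: nbhs_right_lt; rewrite divr_gt0.
move=> [z r] /= [xz /andP[r0 re]] y zy; apply: he.
rewrite -ball_normE /= in xz *.
rewrite -(subrKA z) (splitr e); apply: le_lt_trans (ler_normD _ _) _.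
by apply: ltrD => //; exact: lt_trans re.
Unshelve. all: by end_near. Qed.

End Shears.

(** * Preservation of volume *)

Section Sweeps.
Context {R : realType} {d : nat} (V : 'rV[R]_d -> 'rV[R]_d) (L : R).
Hypothesis d_gt0 : (0 < d)%N.
Hypothesis L_gt0 : 0 < L.
Hypothesis V_lip : forall x y, `|V x - V y| <= L * `|x - y|.
Hypothesis V_indep : forall x k v, V (set_coord x k v) 0 k = V x 0 k.
Local Notation point := 'rV[R]_d.

(** A Gauss-Seidel version of Euler's explicit step of size [h]: every substep
    uses the coordinates already updated, which makes it a shear. *)
Definition sweep (h : R) (s : seq 'I_d) (x : point) : point :=
  foldl (fun y k => shear k (fun z => h * V z 0 k) y) x s.

Lemma sweep_rcons h s k x :
  sweep h (rcons s k) x = shear k (fun z => h * V z 0 k) (sweep h s x).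
Proof. by rewrite /sweep foldl_rcons. Qed.

Lemma field_coord_lip x y k : `|V x 0 k - V y 0 k| <= L * `|x - y|.
Proof.
by have := le_coord_norm (V x - V y) k; rewrite !mxE => /le_trans; apply.
Qed.

Lemma sweep_lip h s x y : 0 <= h ->
  `|sweep h s x - sweep h s y| <= (1 + h * L) ^+ size s * `|x - y|.
Proof.
move=> h0; have hL : 0 <= h * L by rewrite mulr_ge0// ltW.
elim/last_ind: s => [|s k IH]; first by rewrite expr0 mul1r.
rewrite !sweep_rcons size_rcons exprS -mulrA.
set u := sweep h s x in IH *; set v := sweep h s y in IH *.
have step : `|shear k (fun z => h * V z 0 k) u - shear k (fun z => h * V z 0 k) v|
    <= (1 + h * L) * `|u - v|.
  apply: norm_le_coord => [|j]; first by rewrite mulr_ge0// addr_ge0.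
  have cj := le_coord_norm (u - v) j; rewrite !mxE in cj.
  rewrite [X in `|X|]mxE [X in _ + X]mxE !shearE; case: eqP => _; last first.
    by apply: le_trans cj _; rewrite ler_peMl// lerDl.
  have -> : u 0 j + h * V u 0 k - (v 0 j + h * V v 0 k) =
    (u 0 j - v 0 j) + h * (V u 0 k - V v 0 k) by ring.
  apply: le_trans (ler_normD _ _) _; rewrite mulrDl mul1r lerD// normrM.
  by rewrite (ger0_norm h0) -mulrA ler_wpM2l// field_coord_lip.
by apply: le_trans step _; rewrite ler_wpM2l// addr_ge0.
Qed.

Lemma lebesgue_outer_sweep h s A :
  (lebesgue_outer A <= lebesgue_outer (sweep h s @` A))%E.
Proof.
elim/last_ind: s => [|s k IH]; first by rewrite image_id.
apply: le_trans IH _; rewrite (_ : sweep h (rcons s k) =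
  shear k (fun z => h * V z 0 k) \o sweep h s); last first.
  by apply/funext => x; rewrite sweep_rcons.
rewrite -image_comp; apply: (@lebesgue_outer_le_shear _ _ d_gt0 k _ (`|h| * L + 1)).
- by rewrite ltr_wpDl// mulr_ge0// ltW.
- move=> x y; rewrite -mulrBr normrM mulrDl mul1r.
  apply: (@le_trans _ _ (`|h| * L * `|x - y|)); last by rewrite lerDl.
  by rewrite -mulrA ler_wpM2l// field_coord_lip.
- by move=> x v; rewrite V_indep.
Qed.

Variable Phi : point -> R -> point.
Hypothesis Phi_flow : is_flow V Phi.
Variables (D : set point) (M : R).
Hypothesis D_invariant : forall x t, D x -> D (Phi x t).
Hypothesis V_bounded : forall x, D x -> `|V x| <= M.

Lemma flow_coord_derive x t k :
  is_derive t (1 : R) (fun s => Phi x s 0 k) (V (Phi x t) 0 k).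
Proof. by have [_ hx _] := Phi_flow x; exact: (is_derive_rowP _ _ _).1 (hx t) k. Qed.

Lemma flow_displacement x t : D x -> 0 <= t -> `|Phi x t - x| <= M * t.
Proof.
move=> Dx t0; have M0 : 0 <= M by apply: le_trans (V_bounded Dx).
have [x0 _ _] := Phi_flow x.
apply: norm_le_coord => [|k]; first exact: mulr_ge0.
have lin (s : R) : is_derive s (1 : R) (fun s => M * s) M.
  by apply: is_derive_eq; rewrite scaler1.
have := @derive_le_dist R (fun s => Phi x s 0 k) (fun s => V (Phi x s) 0 k)
  (fun s => M * s) (fun=> M) 0 t t0.
rewrite mulr0 subr0 x0 !mxE; apply => s _.
- exact: flow_coord_derive.
- by apply: le_trans (le_coord_norm _ _) _; exact/V_bounded/D_invariant.
Qed.

Lemma sweep_local_error x h : D x -> 0 <= h -> h * L <= 2^-1 ->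
  `|Phi x h - sweep h (enum 'I_d) x| <= 3 * L * M * h ^+ 2.
Proof.
move=> Dx h0 hL; have M0 : 0 <= M by apply: le_trans (V_bounded Dx).
have [x0 _ _] := Phi_flow x.
have hM0 : 0 <= h * M by exact: mulr_ge0.
have E0 : 0 <= 3 * L * M * h ^+ 2.
  by rewrite !mulr_ge0 ?sqr_ge0// ltW.
(* Both the exact and the swept motion of a coordinate differ from the Euler
   step [h * V x 0 k] by a quantity of order two. *)
have exact_step k : `|Phi x h 0 k - x 0 k - h * V x 0 k| <= L * M * h ^+ 2.
  have := @derive_le_dist R (fun s => Phi x s 0 k - s * V x 0 k)
    (fun s => V (Phi x s) 0 k - V x 0 k) (fun s => L * (M * h) * s)
    (fun=> L * (M * h)) 0 h h0.
  rewrite x0 mul0r subr0 mulr0 subr0 addrAC expr2 !mulrA; apply=> s /andP[s0 sh].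
  - have h1 := flow_coord_derive x s k.
    have h2 : is_derive s (1 : R) (fun s => s * V x 0 k) (V x 0 k).
      by apply: is_derive_eq; rewrite /GRing.scale /= mulr1 mulr0 add0r.
    exact: (is_deriveB h1 h2).
  - by apply: is_derive_eq; rewrite scaler1.
  - apply: le_trans (field_coord_lip _ _ _) _; rewrite -mulrA ler_pM2l//.
    by apply: le_trans (flow_displacement Dx s0) _; rewrite ler_wpM2l.
have inv s : uniq s ->
    [/\ forall k, k \notin s -> sweep h s x 0 k = x 0 k,
        forall k, k \in s ->
          `|Phi x h 0 k - sweep h s x 0 k| <= 3 * L * M * h ^+ 2 &
        `|sweep h s x - x| <= 2 * (h * M)].
  elim/last_ind: s => [|s k IH].
    by move=> _; split=> //; rewrite subrr normr0 mulr_ge0.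
  rewrite rcons_uniq => /andP[ks us]; have [out inn near_x] := IH us.
  set y := sweep h s x in out inn near_x.
  have Vy : `|V y 0 k - V x 0 k| <= L * (2 * (h * M)).
    by apply: le_trans (field_coord_lip _ _ _) _; rewrite ler_pM2l.
  have yE j : sweep h (rcons s k) x 0 j =
      if j == k then x 0 j + h * V y 0 k else y 0 j.
    by rewrite sweep_rcons -/y shearE; case: eqP => // ->; rewrite out.
  split=> [j|j|].
  - rewrite mem_rcons inE negb_or yE => /andP[/negbTE-> js]; exact: out.
  - rewrite mem_rcons inE yE; case: eqP => [-> _|_ /= js]; last exact: inn.
    have -> : Phi x h 0 k - (x 0 k + h * V y 0 k) =
        (Phi x h 0 k - x 0 k - h * V x 0 k) - h * (V y 0 k - V x 0 k) by ring.
    apply: le_trans (ler_normB _ _) _; rewrite normrM (ger0_norm h0).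
    have := exact_step k; have := ler_wpM2l h0 Vy; rewrite expr2; lra.
  - apply: norm_le_coord => [|j]; first by rewrite mulr_ge0.
    have yj := le_coord_norm (y - x) j; rewrite !mxE in yj *.
    rewrite yE; case: eqP => [->|_]; last exact: le_trans yj _.
    rewrite addrAC subrr add0r normrM (ger0_norm h0) mulrCA ler_wpM2l//.
    have -> : V y 0 k = V x 0 k + (V y 0 k - V x 0 k) by ring.
    apply: le_trans (ler_normD _ _) _.
    have Vx : `|V x 0 k| <= M by apply: le_trans (le_coord_norm _ _) (V_bounded Dx).
    have : L * (2 * (h * M)) <= M.
      have -> : L * (2 * (h * M)) = (h * L) * 2 * M by ring.
      by rewrite ler_piMl//; lra.
    lra.
have [_ err _] := inv (enum 'I_d) (enum_uniq _).
apply: norm_le_coord => // k; rewrite !mxE; apply: err; exact: mem_enum.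
Qed.

(** The local error of order [h ^+ 2] made at each step is amplified at most by
    the Lipschitz constant of the remaining sweeps. Comparing with the exact
    orbit, which stays in [D], is what allows a bound [M] on [D] only. *)
Lemma sweep_global_error x h n : D x -> 0 <= h -> h * L <= 2^-1 ->
  `|Phi x (n%:R * h) - iter n (sweep h (enum 'I_d)) x| <=
    n%:R * (3 * L * M * h ^+ 2) * (1 + h * L) ^+ (d * n).
Proof.
move=> Dx h0 hL; have M0 : 0 <= M by apply: le_trans (V_bounded Dx).
have [x0 _ _] := Phi_flow x.
set E := 3 * L * M * h ^+ 2; have E0 : 0 <= E.
  by rewrite !mulr_ge0 ?sqr_ge0// ltW.
have q1 : 1 <= (1 + h * L) ^+ d by rewrite exprn_ege1// lerDl mulr_ge0// ltW.
rewrite exprM; set q := (1 + h * L) ^+ d in q1 *.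
have q0 : 0 <= q by apply: le_trans q1.
elim: n => [|n IH]; first by rewrite !mul0r x0 subrr normr0.
have -> : n.+1%:R * h = n%:R * h + h by rewrite -natr1; ring.
rewrite -(flow_add _ _ _ Phi_flow) iterS.
set z := Phi x (n%:R * h) in IH *; set y := iter _ _ _ in IH *.
rewrite -(subrKA (sweep h (enum 'I_d) z)).
apply: le_trans (ler_normD _ _) _.
have h1 := sweep_local_error (D_invariant (n%:R * h) Dx) h0 hL.
have := sweep_lip (enum 'I_d) z y h0; rewrite size_enum_ord -/q => h2.
have h3 : q * `|z - y| <= n%:R * E * q ^+ n.+1.
  by rewrite exprS mulrCA ler_wpM2l.
have h4 : E <= E * q ^+ n.+1 by rewrite ler_peMr// exprn_ege1.
by rewrite -natr1 !mulrDl mul1r; move: h1; rewrite -/E -/z; lra.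
Qed.

(** Liouville's theorem for fields whose [k]-th component does not depend on
    the [k]-th coordinate. Each sweep is a product of shears and preserves
    volume exactly; the sweeps converge uniformly to the flow, and volumes of
    compact sets can only jump up in the limit. *)
Theorem lebesgue_outer_flow A t : A `<=` D -> 0 <= t ->
  compact ((fun x => Phi x t) @` A) ->
  (lebesgue_outer A <= lebesgue_outer ((fun x => Phi x t) @` A))%E.
Proof.
move=> AD t0 cA.
have [[x0 Ax0]|A0] := pselect (exists x, A x); last first.
  have -> : A = set0 by apply/seteqP; split=> // x Ax; apply: A0; exists x.
  by rewrite image_set0.
have M0 : 0 <= M by apply: le_trans (V_bounded (AD _ Ax0)).
set B := _ @` A.
have [->|] := eqVneq (lebesgue_outer B) +oo%E; first by rewrite leey.
rewrite -ltey -ge0_fin_numE ?lebesgue_outer_ge0// => Bfin.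
apply/lee_addgt0Pr => e e0; rewrite -(fineK Bfin) -EFinD.
have [|O [oO BO Or]] := @lebesgue_outer_open _ _ d_gt0 B (fine (lebesgue_outer B) + e).
  by rewrite -{1}(fineK Bfin) lte_fin ltrDl.
apply: le_trans Or.
have [r r0 hr] := compact_open_margin cA oO BO.
pose c := 3 * L * M * t ^+ 2 * expR (L * t * d%:R).
have c0 : 0 <= c by rewrite !mulr_ge0 ?expR_ge0 ?sqr_ge0// ltW.
(* Enough steps for the error [c / n] to be below the margin [r], and for the
   step [t / n] to be admissible in the error estimate. *)
pose n := (Num.truncn (c / r + 2 * (t * L))).+1.
have n_big : c / r + 2 * (t * L) < n%:R by exact: truncnS_gt.
have n0 : 0 < n%:R :> R by [].
pose h := t / n%:R.
have h0 : 0 <= h by rewrite divr_ge0.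
have tL0 : 0 <= t * L by rewrite mulr_ge0// ltW.
have cr0 : 0 <= c / r by rewrite divr_ge0// ltW.
have hL : h * L <= 2^-1.
  by rewrite /h mulrAC ler_pdivrMr//; lra.
have nh : n%:R * h = t by rewrite /h mulrC divfK// gt_eqF.
have iter_le m : (lebesgue_outer A <=
    lebesgue_outer (iter m (sweep h (enum 'I_d)) @` A))%E.
  elim: m => [|m IH]; first by rewrite image_id.
  apply: le_trans IH _; have := lebesgue_outer_sweep h (enum 'I_d).
  by move=> /(_ (iter m (sweep h (enum 'I_d)) @` A)); rewrite image_comp.
apply: le_trans (iter_le n) _; apply: le_lebesgue_outer => _ [x Ax <-].
apply: (hr (Phi x t)); first by exists x.
have := sweep_global_error n (AD _ Ax) h0 hL; rewrite nh => /le_lt_trans; apply.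
apply: (@le_lt_trans _ _ (c / n%:R)); last first.
  rewrite ltr_pdivrMr// mulrC -ltr_pdivrMr//; lra.
have -> : n%:R * (3 * L * M * h ^+ 2) = 3 * L * M * t ^+ 2 / n%:R.
  by rewrite /h; field; rewrite gt_eqF.
rewrite /c [leLHS]mulrAC ler_wpM2r ?invr_ge0// ler_wpM2l//.
  by rewrite !mulr_ge0 ?sqr_ge0// ltW.
apply: (@le_trans _ _ (expR (h * L) ^+ (d * n))).
  apply: lerXn2r; rewrite ?nnegrE ?expR_ge0 ?expR_ge1Dx//.
  by rewrite addr_ge0// mulr_ge0// ltW.
rewrite -expRM_natr ler_expR natrM /h le_eqVlt; apply/orP; left; apply/eqP.
by field; rewrite gt_eqF.
Qed.

End Sweeps.

(** * Poincare recurrence *)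

Section Recurrence.
Context {R : realType} {d : nat}.
Hypothesis d_gt0 : (0 < d)%N.
Local Notation point := 'rV[R]_d.

Lemma lebesgue_outer_bigcup_countable (I : countType) (F : I -> set point) :
  (forall i, lebesgue_outer (F i) = 0%E) ->
  lebesgue_outer (\bigcup_i F i) = 0%E.
Proof.
move=> F0; pose G n := if unpickle n is Some i then F i else set0.
apply: (@lebesgue_outer_sub0 _ _ _ (\bigcup_n G n)).
  by move=> x [i _ xi]; exists (pickle i) => //; rewrite /G pickleK.
apply: (lebesgue_outer_bigcup0) => n; rewrite /G.
by case: unpickle => // *; exact: lebesgue_outer_set0.
Qed.

Lemma lebesgue_outer_compactU (A B : set point) : compact A -> compact B ->
  A `&` B = set0 ->
  (lebesgue_outer A + lebesgue_outer B <= lebesgue_outer (A `|` B))%E.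
Proof.
move=> cA cB AB0.
have oB : open (~` B).
  by apply: closed_openC; apply: compact_closed => //; exact: norm_hausdorff.
have AB : A `<=` ~` B.
  by move=> x Ax Bx; have : (A `&` B) x by []; rewrite AB0.
have [r r0 hr] := compact_open_margin cA oB AB.
apply: (lebesgue_outer_separated d_gt0 r0) => x y Ax By.
by rewrite leNgt; apply/negP => /(hr _ _ Ax).
Qed.

Lemma lebesgue_outer_bounded (A : set point) (r : R) :
  (forall x, A x -> `|x| <= r) -> exists v : R, (lebesgue_outer A <= v%:E)%E.
Proof.
move=> Ar; pose B : point * point := (const_mx (- `|r|), const_mx `|r|).
have pB : proper_box B by move=> k; rewrite !mxE; have := normr_ge0 r; lra.
exists (box_volume B); apply: le_trans (lebesgue_outer_box d_gt0 pB).
apply: le_lebesgue_outer => x /Ar xr k; rewrite !mxE -ler_norml.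
by apply: le_trans (le_coord_norm x k) _; apply: le_trans xr (ler_norm r).
Qed.

Lemma recurrent_of_frequent (Phi : point -> R -> point) x :
  (forall e, 0 < e -> forall n0, exists n,
     (n0 <= n)%N /\ `|x - Phi x n%:R| < e) ->
  recurrent Phi x.
Proof.
move=> freq W /nbhs_ballP[e /= e0 eW].
have /choice[f hf] := freq e e0.
pose u := fix u k := if k is k'.+1 then f (u k').+1 else f 0%N.
have uS k : (u k < u k.+1)%N by have [] := hf (u k).+1.
have uk k : (k <= u k)%N.
  by elim: k => // k IH; apply: leq_ltn_trans IH (uS k).
exists (fun k => (u k)%:R); split.
- apply/increasing_seqP => k; by rewrite ltr_nat.
- apply/cvgryPge => A; exists (Num.truncn A).+1 => // k /= Ak.
  apply: le_trans (ltW (truncnS_gt A)) _; rewrite ler_nat.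
  exact: leq_trans (uk k).
- move=> k; apply: eW; rewrite -ball_normE /=.
  by case: k => [|k]; [have [] := hf 0%N | have [] := hf (u k).+1].
Qed.

Variables (Phi : point -> R -> point) (D : set point) (rad : R).
Hypothesis Phi0 : forall x, Phi x 0 = x.
Hypothesis PhiD : forall x s t, Phi (Phi x s) t = Phi x (s + t).
Hypothesis Phi_continuous : forall t, continuous (fun x => Phi x t).
Hypothesis D_closed : closed D.
Hypothesis D_bounded : forall x, D x -> `|x| <= rad.
Hypothesis D_invariant : forall x t, D x -> D (Phi x t).
Hypothesis Phi_volume : forall A t, A `<=` D -> 0 <= t ->
  compact ((fun x => Phi x t) @` A) ->
  (lebesgue_outer A <= lebesgue_outer ((fun x => Phi x t) @` A))%E.

(** A wandering set is null: its images under the iterates are disjoint, are at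
    least as large as the set itself, and all fit into [D]. *)
Lemma wandering_null (A : set point) (tau : R) : 0 <= tau ->
  compact A -> A `<=` D ->
  (forall x n, A x -> ~ A (Phi x (n.+1%:R * tau))) ->
  lebesgue_outer A = 0%E.
Proof.
move=> tau0 cA AD wander.
pose F n := (fun x => Phi x (n%:R * tau)) @` A.
have cF n : compact (F n).
  apply: continuous_compact => //.
  by apply: continuous_subspaceT; exact: Phi_continuous.
have le_F n : (lebesgue_outer A <= lebesgue_outer (F n))%E.
  by apply: Phi_volume => //; [rewrite mulr_ge0 | exact: cF].
pose U := fix U n := if n is n'.+1 then U n' `|` F n' else set0.
have UP n x : U n x -> exists2 i, (i < n)%N & F i x.
  elim: n => // n IH [/IH[i ni Fi]|Fn]; last by exists n.
  by exists i => //; exact: ltnW.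
have cU n : compact (U n).
  by elim: n => [|n IH]; [exact: compact0 | exact: compactU].
have UF n : U n `&` F n = set0.
  apply/seteqP; split=> // x [/UP[i ni [y Ay <-]] [z Az e]].
  pose m := (n - i.+1)%N.
  have nE : n%:R * tau = m.+1%:R * tau + i%:R * tau.
    by rewrite -mulrDl -natrD addSn -addnS subnK.
  apply: (wander z m Az); suff -> : Phi z (m.+1%:R * tau) = y by [].
  have := congr1 (fun w => Phi w (- (i%:R * tau))) e.
  by rewrite nE !PhiD addrK subrr Phi0.
have [v hv] := lebesgue_outer_bounded D_bounded.
have FD n : F n `<=` D by move=> _ [x Ax <-]; apply: D_invariant; exact: AD.
have le_U n : (lebesgue_outer A *+ n <= lebesgue_outer (U n))%E.
  elim: n => [|n IH]; first by rewrite mule0n lebesgue_outer_ge0.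
  apply: le_trans (lebesgue_outer_compactU (cU n) (cF n) (UF n)).
  by rewrite muleS addeC; exact: leeD.
have Uv n : (lebesgue_outer A *+ n <= v%:E)%E.
  apply: le_trans (le_U n) _; apply: le_trans hv; apply: le_lebesgue_outer.
  by move=> x /UP[i _]; exact: FD.
have Afin : lebesgue_outer A \is a fin_num.
  rewrite ge0_fin_numE ?lebesgue_outer_ge0//; apply: le_lt_trans (ltry v).
  by have := Uv 1%N.
have := lebesgue_outer_ge0 A; move: Uv; rewrite -(fineK Afin).
set a := fine _ => Uv; rewrite lee_fin le_eqVlt => /orP[/eqP<-//|a0].
have := Uv (Num.truncn (v / a)).+1.
rewrite -EFin_natmul lee_fin -mulr_natl -ler_pdivlMr// leNgt => /negP[].
exact: truncnS_gt.
Qed.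

(** Poincare's recurrence theorem. A point of [D] that is not recurrent lies in
    some closed ball of a countable family and, after some time, never visits
    the open ball of twice the radius; for given balls and time, such points
    form a wandering compact set. *)
Theorem recurrence_on_invariant_set :
  lebesgue_outer [set x | D x /\ ~ recurrent Phi x] = 0%E.
Proof.
pose rho (m : nat) : R := m.+1%:R^-1.
have rho0 m : 0 < rho m by rewrite invr_gt0.
pose cen (z : 'rV[int]_d) (m : nat) : point := \row_k ((z 0 k)%:~R * rho m).
pose A (i : 'rV[int]_d * nat * nat) := let: (z, m, n0) := i in
  [set x | [/\ D x, `|x - cen z m| <= rho m &
    forall n, (n0 < n)%N -> 2 * rho m <= `|Phi x n%:R - cen z m|]].
apply: (@lebesgue_outer_sub0 _ _ _ (\bigcup_i A i)).
  move=> x [Dx nrec].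
  have [e [e0 [n0 away]]] : exists e, 0 < e /\ exists n0, forall n, (n0 <= n)%N ->
      e <= `|x - Phi x n%:R|.
    apply: contrapT => h; apply: nrec; apply: recurrent_of_frequent => e e0 n0.
    apply: contrapT => h'; apply: h; exists e; split => //; exists n0 => n n0n.
    by rewrite leNgt; apply/negP => lt; apply: h'; exists n.
  (* The open ball of radius [2 rho] around a centre within [rho] of [x] lies in
   the ball of radius [3 rho <= e] around [x]. *)
pose m := Num.truncn (3 / e).
  have rhom : 3 * rho m <= e.
    rewrite /rho ler_pdivrMr// mulrC -ler_pdivrMr//.
    by apply: ltW; exact: truncnS_gt.
  pose z : 'rV[int]_d := \row_k Num.floor (x 0 k / rho m).
  have xz : `|x - cen z m| <= rho m.
    apply: norm_le_coord => [|k]; first exact: ltW.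
    rewrite !mxE; have /andP[f1 f2] := floor_itv (x 0 k / rho m).
    rewrite ler_pdivlMr// in f1; rewrite ltr_pdivrMr// intrD mulrDl mul1r in f2.
    by rewrite ger0_norm; lra.
  exists (z, m, n0) => //=; split => // n n0n.
  have := away n (ltnW n0n); rewrite -(subrKA (cen z m)) => h.
  have := ler_normD (x - cen z m) (cen z m - Phi x n%:R).
  by rewrite (distrC (cen z m)); lra.
apply: lebesgue_outer_bigcup_countable => -[[z m] n0].
apply: (@wandering_null _ n0.+1%:R) => //.
- apply: bounded_closed_compact.
    exists rad; split; first exact: num_real.
    by move=> r rr x [/D_bounded xr _ _]; apply: le_trans xr (ltW rr).
  have -> : A (z, m, n0) = D `&` closed_ball (cen z m) (rho m) `&`
      \bigcap_(n in [set n | (n0 < n)%N])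
        (fun x => Phi x n%:R) @^-1` (~` ball (cen z m) (2 * rho m)).
    apply/seteqP; split=> x.
      case=> Dx xz away; split.
        by split => //; rewrite closed_ballE// /closed_ball_ /= distrC.
      move=> n /= /away; rewrite -ball_normE /= distrC => h.
      by apply/negP; rewrite -leNgt.
    case=> -[Dx]; rewrite closed_ballE// /closed_ball_ /= distrC => xz away.
    split=> // n /away /=; rewrite -ball_normE /= distrC => /negP.
    by rewrite -leNgt.
  apply: closedI; first by apply: closedI => //; exact: closed_ball_closed.
  apply: closed_bigI => n _; apply: preimage_closed.
    by move=> x _; exact: Phi_continuous.
  by apply: open_closedC; exact: ball_open.
- by move=> x [].
- move=> x n [Dx xz away] [_ yz _].
  have n0_lt : (n0 < n.+1 * n0.+1)%N by exact: leq_pmull.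
  by have := away _ n0_lt; rewrite natrM; have := rho0 m; lra.
Qed.

End Recurrence.

(** * Potentials and Hamiltonian fields *)

Definition locally_lipschitz (R : realType) (h : R -> R) : Prop :=
  forall K : R, exists2 L, 0 < L &
    forall s t, `|s| <= K -> `|t| <= K -> `|h s - h t| <= L * `|s - t|.

Lemma C1_locally_lipschitz (R : realType) (h dh : R -> R) :
  (forall t : R, is_derive t (1 : R) h (dh t)) -> continuous dh ->
  locally_lipschitz h.
Proof.
move=> hd cd K; have [K0|K0] := leP 0 K; last first.
  by exists 1 => // s t sK; have := normr_ge0 s; lra.
have [||m _ hm] := @EVT_max R (fun t => `|dh t|) (- K) K; first by lra.
  apply: continuous_subspaceT => x.
  by apply: (@continuous_comp _ _ _ dh (fun y : R => `|y|));
    [exact: cd | exact: norm_continuous].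
pose L := `|dh m| + 1; have L0 : 0 < L by rewrite ltr_wpDl.
have key s t : s <= t -> `|s| <= K -> `|t| <= K -> `|h t - h s| <= L * (t - s).
  rewrite mulrBr => st sK tK.
  have /andP[s1 s2] : - K <= s <= K by rewrite -ler_norml.
  have /andP[t1 t2] : - K <= t <= K by rewrite -ler_norml.
  have lin (r : R) : is_derive r (1 : R) (fun r => L * r) L.
    by apply: is_derive_eq; rewrite scaler1.
  apply: (@derive_le_dist R h dh (fun r => L * r) (fun=> L)) => // r /andP[sr rt].
  rewrite /L; have := hm r; rewrite in_itv /= => H; have {}H := H _.
  by have : `|dh r| <= `|dh m| by [apply: H; apply/andP; split; lra]; lra.
exists L => // s t sK tK; have [st|ts] := leP s t.
  by rewrite distrC [`|s - t|]distrC [`|t - s|]ger0_norm ?subr_ge0//; exact: key.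
rewrite [`|s - t|]ger0_norm ?subr_ge0; last exact: ltW.
by apply: key => //; exact: ltW.
Qed.

Section Clamp.
Context {R : realType} (K : R).
Hypothesis K_ge0 : 0 <= K.

Definition clamp (s : R) : R := Num.max (- K) (Num.min K s).

Lemma clamp_le s : `|clamp s| <= K.
Proof.
rewrite ler_norml /clamp le_max lexx /= ge_max ge_min lexx /= andbT.
by have := K_ge0; lra.
Qed.

Lemma clamp_id s : `|s| <= K -> clamp s = s.
Proof. by rewrite ler_norml /clamp => /andP[h1 h2]; rewrite min_r// max_r. Qed.

Lemma clamp_mono s t : s <= t -> clamp s <= clamp t.
Proof.
move=> st; rewrite /clamp; have := K_ge0; rewrite /Num.max /Num.min.
by do 4 case: ifPn; rewrite -?leNgt; lra.
Qed.

Lemma clamp_lip s t : `|clamp s - clamp t| <= `|s - t|.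
Proof.
wlog st : s t / s <= t.
  by move=> H; have [/H//|/ltW/H] := leP s t; rewrite distrC [leRHS]distrC.
rewrite distrC [leRHS]distrC !ger0_norm ?subr_ge0 ?clamp_mono//.
have := K_ge0; rewrite /clamp /Num.max /Num.min.
by do 4 case: ifPn; rewrite -?leNgt; lra.
Qed.

End Clamp.

(** The equations of motion [x_k' = sum_l J k l * dH/dx_l] for the Hamiltonian
    [H x = sum_l C_l (x_l)] with [C_l' = c_l] and the Poisson matrix [J]. *)
Definition hamiltonian_field (R : realType) (d : nat) (J : 'M[R]_d)
    (c : 'I_d -> R -> R) (x : 'rV[R]_d) : 'rV[R]_d :=
  \row_k \sum_l J k l * c l (x 0 l).

Definition skew (R : realType) (d : nat) (J : 'M[R]_d) : Prop :=
  forall k l, J k l = - J l k.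

Lemma skew_diag (R : realType) (d : nat) (J : 'M[R]_d) k : skew J -> J k k = 0.
Proof. by move=> /(_ k k); lra. Qed.

(** The quadratic form of a skew matrix vanishes: this is conservation of energy. *)
Lemma skew_form0 (R : realType) (d : nat) (J : 'M[R]_d) (v : 'I_d -> R) : skew J ->
  \sum_k (v k * \sum_l J k l * v l) = 0.
Proof.
move=> sJ; have -> : \sum_k (v k * \sum_l J k l * v l) =
    \sum_k \sum_l v k * (J k l * v l).
  by apply: eq_bigr => k _; rewrite big_distrr.
set S := LHS; have SN : S = - S.
  rewrite {1}/S exchange_big -sumrN /=; apply: eq_bigr => k _.
  rewrite -sumrN; apply: eq_bigr => l _; rewrite (sJ l k); ring.
by lra.
Qed.

Lemma energy_conserved (R : realType) (d : nat) (J : 'M[R]_d)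
    (c C : 'I_d -> R -> R) u : skew J ->
  (forall l (t : R), is_derive t (1 : R) (C l) (c l t)) ->
  integral_curve (hamiltonian_field J c) u ->
  forall t, \sum_l C l (u t 0 l) = \sum_l C l (u 0 0 l).
Proof.
move=> sJ hC hu t; pose E s := \sum_l C l (u s 0 l).
have hE (s : R) : is_derive s (1 : R) E 0.
  rewrite -(skew_form0 (fun l => c l (u s 0 l)) sJ).
  apply: is_derive_sum_fun => l.
  have := (is_derive_rowP _ _ _).1 (hu s) l; rewrite mxE => h.
  exact: (is_derive1_comp (hC l (u s 0 l)) h).
have hE0 (s : R) : is_derive s (1 : R) (fun=> 0 : R) 0 by exact: is_derive_cst.
by have [t0|/ltW t0] := leP 0 t;
  have := derive_eq_sub t0 (fun s _ => hE s) (fun s _ => hE0 s); rewrite /E; lra.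
Qed.

Section Potential.
Context {R : realType} (c C : R -> R) (z : R).
Hypothesis c_nondec : forall s t, s <= t -> c s <= c t.
Hypothesis c_z : c z = 0.
Hypothesis C_derive : forall t : R, is_derive t (1 : R) C (c t).
Hypothesis C_z : C z = 0.

Lemma potential_right s t : z <= s -> s <= t -> C s <= C t.
Proof.
move=> zs st; apply: (@derive_ge0_le R C c s t st) => // r /andP[sr _].
by rewrite -c_z c_nondec// (le_trans zs).
Qed.

Lemma potential_left s t : s <= t -> t <= z -> C t <= C s.
Proof.
move=> st tz; have := @derive_ge0_le R (- C) (fun r => - c r) s t st.
rewrite !fctE lerN2; apply => r /andP[_ rt].
by rewrite oppr_ge0 -c_z c_nondec// (le_trans rt).
Qed.

Lemma potential_ge0 s : 0 <= C s.
Proof.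
by rewrite -C_z; have [zs|/ltW sz] := leP z s;
  [exact: potential_right | exact: potential_left].
Qed.

Lemma potential_confined K h : - K <= z <= K -> h < C K -> h < C (- K) ->
  forall s, C s <= h -> `|s| <= K.
Proof.
move=> /andP[z1 z2] hK hNK s Cs; rewrite ler_norml !leNgt.
apply/andP; split; apply/negP => sK.
  by have := potential_left (ltW sK) z1; lra.
by have := potential_right z2 (ltW sK); lra.
Qed.

Hypothesis c_incr : forall s t, s < t -> c s < c t.

(** At distance 1 from the equilibrium [z] the force is already bounded away from
    zero, and it does not decrease further out, so that the potential grows at
    least linearly in both directions. *)
Lemma potential_coercive h : exists2 K0, 0 <= K0 &
  forall K, K0 <= K -> h < C K /\ h < C (- K).
Proof.
pose a := c (z + 1); pose b := - c (z - 1).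
have a0 : 0 < a by rewrite -c_z c_incr// ltrDl.
have b0 : 0 < b by rewrite oppr_gt0 -c_z c_incr// gtrBl.
have right s : z + 1 <= s -> a * (s - (z + 1)) <= C s.
  move=> zs; have := @derive_ge0_le R (fun r => C r - a * r) (fun r => c r - a) _ _ zs.
  have C0 := potential_ge0 (z + 1).
  suff H : C (z + 1) - a * (z + 1) <= C s - a * s by move=> _; lra.
  apply: (@derive_ge0_le R (fun r => C r - a * r) (fun r => c r - a) _ _ zs).
    move=> r _; have lin : is_derive r (1 : R) (fun r => a * r) a.
      by apply: is_derive_eq; rewrite scaler1.
    exact: (is_deriveB (C_derive r) lin).
  by move=> r /andP[zr _]; rewrite subr_ge0 c_nondec.
have left s : s <= z - 1 -> b * (z - 1 - s) <= C s.
  move=> sz; have C0 := potential_ge0 (z - 1).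
  suff H : - (C s + b * s) <= - (C (z - 1) + b * (z - 1)) by lra.
  apply: (@derive_ge0_le R (fun r => - (C r + b * r)) (fun r => - (c r + b)) _ _ sz).
    move=> r _; have lin : is_derive r (1 : R) (fun r => b * r) b.
      by apply: is_derive_eq; rewrite scaler1.
    exact: (is_deriveN (is_deriveD (C_derive r) lin)).
  by move=> r /andP[_ rz]; rewrite oppr_ge0 /b subr_le0 c_nondec.
exists (`|z| + 1 + `|h| / a + `|h| / b + 1).
  by rewrite !addr_ge0// divr_ge0// ltW.
move=> K hK; have ha : 0 <= `|h| / a by rewrite divr_ge0// ltW.
have hb : 0 <= `|h| / b by rewrite divr_ge0// ltW.
have /andP[z1 z2] : - `|z| <= z <= `|z| by rewrite -ler_norml.
have hh := ler_norm h.
have ea : a * (`|h| / a + 1) = `|h| + a by field; rewrite gt_eqF.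
have eb : b * (`|h| / b + 1) = `|h| + b by field; rewrite gt_eqF.
split.
  apply: lt_le_trans (right K _); last by lra.
  apply: (@lt_le_trans _ _ (a * (`|h| / a + 1))); first by lra.
  by rewrite ler_pM2l//; lra.
apply: lt_le_trans (left (- K) _); last by lra.
apply: (@lt_le_trans _ _ (b * (`|h| / b + 1))); first by lra.
by rewrite ler_pM2l//; lra.
Qed.

End Potential.

(** * Recurrence of separable Hamiltonian systems *)

Lemma continuous_sum_coord (R : realType) (d : nat) (C : 'I_d -> R -> R) (s : seq 'I_d) :
  (forall l, continuous (C l)) ->
  continuous (fun x : 'rV[R]_d => \sum_(l <- s) C l (x 0 l)).
Proof.
move=> cC; elim: s => [|l s IH].
  have -> : (fun x : 'rV[R]_d => \sum_(l <- [::]) C l (x 0 l)) = cst 0.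
    by apply/funext => x; rewrite big_nil.
  by move=> x; exact: cst_continuous.
have -> : (fun x : 'rV[R]_d => \sum_(l <- l :: s) C l (x 0 l)) =
    (fun x => C l (x 0 l)) + (fun x => \sum_(l <- s) C l (x 0 l)).
  by apply/funext => x; rewrite big_cons.
move=> x; apply: continuousD; last exact: IH.
apply: (@continuous_comp _ _ _ (fun y : 'rV[R]_d => y 0 l) (C l)); last exact: cC.
exact: coord_continuous.
Qed.

Lemma antiderivative_at (R : realType) (f : R -> R) (z : R) : continuous f ->
  exists F : R -> R, F z = 0 /\ forall t : R, is_derive t (1 : R) F (f t).
Proof.
move=> /antiderivative[F [_ hF]]; exists (fun t => F t - F z).
split=> [|t]; first by rewrite subrr.
have := is_deriveB (hF t) (is_derive_cst (F z) t (1 : R)).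
by rewrite subr0.
Qed.

Lemma uniform_bound (R : realType) (I : finType) (P : I -> R -> Prop) :
  (forall i, exists2 K, 0 <= K & forall K', K <= K' -> P i K') ->
  exists2 K, 0 <= K & forall i, P i K.
Proof.
move=> h; have /choice[f hf] : forall i, exists K, 0 <= K /\ forall K', K <= K' -> P i K'.
  by move=> i; have [K ? ?] := h i; exists K.
exists (\sum_i f i); first by apply: sumr_ge0 => i _; have [] := hf i.
move=> i; apply: (hf i).2; rewrite (bigD1 i)//= lerDl.
by apply: sumr_ge0 => j _; have [] := hf j.
Qed.

Section SeparableHamiltonian.
Context {R : realType} {d : nat} (J : 'M[R]_d) (c : 'I_d -> R -> R) (z : 'I_d -> R).
Hypothesis d_gt0 : (0 < d)%N.
Hypothesis J_skew : skew J.
Hypothesis c_lip : forall l, locally_lipschitz (c l).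
Hypothesis c_incr : forall l s t, s < t -> c l s < c l t.
Hypothesis c_z : forall l, c l (z l) = 0.
Local Notation point := 'rV[R]_d.
Local Notation V := (hamiltonian_field J c).

Lemma hamiltonian_nondec l s t : s <= t -> c l s <= c l t.
Proof. by rewrite le_eqVlt => /orP[/eqP->//|/(c_incr l)/ltW]. Qed.

Variable C : 'I_d -> R -> R.
Hypothesis C_derive : forall l (t : R), is_derive t (1 : R) (C l) (c l t).
Hypothesis C_z : forall l, C l (z l) = 0.

Definition energy (x : point) : R := \sum_l C l (x 0 l).

Lemma truncation_level (h : R) : exists2 K, 0 <= K &
  forall l, [/\ - K <= z l <= K, h < C l K & h < C l (- K)].
Proof.
apply: uniform_bound => l.
have [K0 K00 hK0] := potential_coercive (@hamiltonian_nondec l) (c_z l)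
  (C_derive l) (C_z l) (c_incr l) h.
exists (K0 + `|z l|); first by rewrite addr_ge0.
move=> K hK; have [|h1 h2] := hK0 K; first by have := normr_ge0 (z l); lra.
by split => //; rewrite -ler_norml; lra.
Qed.

Section Truncation.
Variables (h K : R).
Hypothesis K_ge0 : 0 <= K.
Hypothesis K_level : forall l, [/\ - K <= z l <= K, h < C l K & h < C l (- K)].

Definition truncated (l : 'I_d) (s : R) : R := c l (clamp K s).
Local Notation W := (hamiltonian_field J truncated).

Lemma truncated_eq l s : `|s| <= K -> truncated l s = c l s.
Proof. by move=> sK; rewrite /truncated clamp_id. Qed.

Lemma truncated_nondec l s t : s <= t -> truncated l s <= truncated l t.
Proof. by move=> st; apply: hamiltonian_nondec; exact: clamp_mono. Qed.

Lemma truncated_z l : truncated l (z l) = 0.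
Proof. by have [zK _ _] := K_level l; rewrite truncated_eq ?c_z// ler_norml. Qed.

Lemma truncated_lip : exists2 L, 0 < L &
  forall l s t, `|truncated l s - truncated l t| <= L * `|s - t|.
Proof.
have [L L0 hL] : exists2 L, 0 <= L & forall l, forall s t,
    `|truncated l s - truncated l t| <= L * `|s - t|.
  apply: uniform_bound => l; have [L L0 hL] := c_lip l K.
  exists L => [|L' LL' s t]; first exact: ltW.
  apply: le_trans (hL _ _ (clamp_le K_ge0 s) (clamp_le K_ge0 t)) _.
  by apply: ler_pM; rewrite ?clamp_lip// ltW.
exists (L + 1) => [|l s t]; first by rewrite ltr_wpDl.
by apply: le_trans (hL l s t) _; rewrite ler_wpM2r// lerDl.
Qed.

Lemma truncated_continuous l : continuous (truncated l).
Proof.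
have [L L0 hL] := truncated_lip; move=> x.
apply: continuous_at_dist => e e0; near=> y.
apply: le_trans (hL l x y) _; rewrite -ler_pdivlMl//.
near: y; apply: (@near_dist_le R R x).
by rewrite mulr_gt0// invr_gt0.
Unshelve. all: by end_near. Qed.

Lemma truncated_field_lip : exists2 L, 0 < L &
  forall x y, `|W x - W y| <= L * `|x - y|.
Proof.
have [L L0 hL] := truncated_lip.
pose S := \sum_k \sum_l `|J k l|; have S0 : 0 <= S.
  by apply: sumr_ge0 => k _; exact: sumr_ge0.
exists ((S + 1) * L) => [|x y]; first by rewrite mulr_gt0// ltr_wpDl.
apply: norm_le_coord => [|k]; first by rewrite !mulr_ge0 ?(ltW L0)// addr_ge0.
rewrite !mxE -sumrB; apply: le_trans (ler_norm_sum _ _ _) _.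
apply: (@le_trans _ _ (\sum_l `|J k l| * (L * `|x - y|))).
  apply: ler_sum => l _; rewrite -mulrBr normrM ler_wpM2l//.
  apply: le_trans (hL _ _ _) _; rewrite ler_pM2l//.
  by have := le_coord_norm (x - y) l; rewrite !mxE.
rewrite -big_distrl /= -mulrA ler_wpM2r ?mulr_ge0 ?(ltW L0)//.
apply: (@le_trans _ _ S); last by rewrite lerDl.
rewrite /S [leRHS](bigD1 k)//= lerDl.
by apply: sumr_ge0 => j _; exact: sumr_ge0.
Qed.

Lemma truncated_field_indep x k v : W (set_coord x k v) 0 k = W x 0 k.
Proof.
rewrite !mxE; apply: eq_bigr => l _; rewrite mxE; case: eqP => // ->.
by rewrite skew_diag// !mul0r.
Qed.

Lemma energy_confined (y : point) : energy y <= h -> forall l, `|y 0 l| <= K.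
Proof.
move=> yh l; have [zK hK hNK] := K_level l.
apply: (potential_confined (@hamiltonian_nondec l) (c_z l) (C_derive l) zK hK hNK).
apply: le_trans yh; rewrite /energy [leRHS](bigD1 l)//= lerDl; apply: sumr_ge0 => j _.
exact: (potential_ge0 (@hamiltonian_nondec j) (c_z j) (C_derive j) (C_z j)).
Qed.

Lemma energy_sublevel_bounded x : energy x <= h -> `|x| <= K.
Proof. by move=> xh; apply: norm_le_coord => //; exact: energy_confined. Qed.

(** Truncating the forces outside [-K, K] makes the field globally Lipschitz
    without changing the motions of energy at most [h]: the energy of the
    truncated system is conserved as well, and confines these motions to the
    cube where nothing has been changed. *)
Lemma truncated_flow : exists Psi, is_flow W Psi /\ forall x, energy x <= h ->
  [/\ integral_curve V (Psi x), forall t, energy (Psi x t) <= h &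
      forall u, integral_curve V u -> u 0 = x -> u =1 Psi x].
Proof.
have [L L0 hL] := truncated_field_lip.
have [Psi hPsi] := lipschitz_flow L0 hL; exists Psi; split => // x xh.
have /choice[CK hCK] : forall l, exists F : R -> R, F (z l) = 0 /\
    forall t : R, is_derive t (1 : R) F (truncated l t).
  by move=> l; apply: antiderivative_at; exact: truncated_continuous.
have CKE l s : `|s| <= K -> CK l s = C l s.
  have [CK0 dCK] := hCK l; have [zK _ _] := K_level l.
  have /andP[z1 z2] := zK; rewrite ler_norml => /andP[s1 s2].
  have dC a b (r : R) : - K <= a -> b <= K -> a <= r <= b ->
      is_derive r (1 : R) (C l) (truncated l r).
    move=> aK bK /andP[ar rb]; rewrite truncated_eq//.
    by rewrite ler_norml; apply/andP; split; lra.
  have [zs|/ltW sz] := leP (z l) s.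
    have := derive_eq_sub zs (fun r _ => dCK r) (fun r => dC _ _ r z1 s2).
    by rewrite CK0 C_z !subr0.
  have := derive_eq_sub sz (fun r _ => dCK r) (fun r => dC _ _ r s1 z2).
  by rewrite CK0 C_z; lra.
have KN : `|- K| <= K by rewrite normrN ger0_norm.
have KP : `|K| <= K by rewrite ger0_norm.
have CK_confined (y : point) : \sum_l CK l (y 0 l) <= h -> forall l, `|y 0 l| <= K.
  move=> yh l; have [zK hK hNK] := K_level l.
  have [CK0 dCK] := hCK l.
  have hK' : h < CK l K by rewrite CKE.
  have hNK' : h < CK l (- K) by rewrite CKE.
  apply: (potential_confined (@truncated_nondec l) (truncated_z l) dCK zK hK' hNK').
  apply: le_trans yh; rewrite [leRHS](bigD1 l)//= lerDl; apply: sumr_ge0 => j _.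
  exact: (potential_ge0 (@truncated_nondec j) (truncated_z j) (hCK j).2 (hCK j).1).
have WV (y : point) : (forall l, `|y 0 l| <= K) -> W y = V y.
  move=> yK; apply/rowP => k; rewrite !mxE; apply: eq_bigr => l _.
  by rewrite truncated_eq.
have [x0 hx ux] := hPsi x.
have Psi_le t : \sum_l CK l (Psi x t 0 l) <= h.
  rewrite (energy_conserved J_skew (fun l => (hCK l).2) hx) x0.
  apply: (le_trans _ xh); rewrite le_eqVlt; apply/orP; left; apply/eqP.
  by apply: eq_bigr => l _; apply: CKE; exact: (energy_confined xh).
have Psi_in t := CK_confined _ (Psi_le t).
split=> [t|t|u hu u0].
- rewrite -WV; [exact: hx | exact: Psi_in].
- apply: le_trans (Psi_le t); rewrite le_eqVlt; apply/orP; left; apply/eqP.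
  by apply: eq_bigr => l _; rewrite CKE.
- apply: ux => // t; rewrite WV; first exact: hu.
  apply: energy_confined.
  by rewrite /energy (energy_conserved J_skew C_derive hu) u0.
Qed.

Lemma truncated_recurrence Psi : is_flow W Psi ->
  (forall x t, energy x <= h -> energy (Psi x t) <= h) ->
  lebesgue_outer [set x | energy x <= h /\ ~ recurrent Psi x] = 0%E.
Proof.
move=> hPsi inv; have [L L0 hL] := truncated_field_lip.
have cC l : continuous (C l) by apply: is_derive_continuous; exact: C_derive.
apply: (@recurrence_on_invariant_set _ _ d_gt0 Psi [set x | energy x <= h] K).
- by move=> x; have [] := hPsi x.
- by move=> x s t; exact: flow_add.
- by move=> t; exact: (lipschitz_flow_continuous L0 hL hPsi).
- have -> : [set x | energy x <= h] = energy @^-1` [set r | r <= h] by [].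
  apply: preimage_closed; last exact: closed_le.
  by move=> x _; exact: continuous_sum_coord.
- by move=> x; exact: energy_sublevel_bounded.
- exact: inv.
- move=> A t AD t0 cA.
  apply: (@lebesgue_outer_flow _ _ W L d_gt0 L0 hL truncated_field_indep Psi hPsi
    [set x | energy x <= h] (`|W 0| + L * K)) => // x xh.
  have -> : W x = W 0 + (W x - W 0) by rewrite addrC subrK.
  apply: le_trans (ler_normD _ _) _; rewrite lerD2l.
  apply: le_trans (hL _ _) _; rewrite subr0 ler_pM2l//.
  exact: energy_sublevel_bounded.
Qed.

End Truncation.

(** The truncation level depends on the energy of the starting point, and the flow
    is put together from the truncated ones; the space is the union of countably
    many sublevel sets of the energy. *)
Theorem separable_hamiltonian_recurrence : has_poincare_recurrent_flow V.
Proof.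
have /choice[K hK] : forall h, exists K, 0 <= K /\
    forall l, [/\ - K <= z l <= K, h < C l K & h < C l (- K)].
  by move=> h; have [K] := truncation_level h; exists K.
have /choice[Psi hPsi] : forall h, exists Psi,
    is_flow (hamiltonian_field J (truncated (K h))) Psi /\
    forall x, energy x <= h ->
    [/\ integral_curve V (Psi x), forall t, energy (Psi x t) <= h &
      forall u, integral_curve V u -> u 0 = x -> u =1 Psi x].
  by move=> h; have [K0 Kh] := hK h; exact: truncated_flow.
pose Phi x := Psi (energy x) x.
have Phi_flow : is_flow V Phi.
  move=> x; have [fl low] := hPsi (energy x); have [h1 _ h3] := low x (lexx _).
  by split => //; have [] := fl x.
exists Phi => //; rewrite /poincare_recurrent.
apply: (@lebesgue_outer_sub0 _ _ _ (\bigcup_(n : nat)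
    [set x | energy x <= n%:R /\ ~ recurrent (Psi n%:R) x])).
  move=> x nrec; have xn : energy x <= (Num.truncn (energy x)).+1%:R.
    by apply: ltW; exact: truncnS_gt.
  exists (Num.truncn (energy x)).+1 => //; split => // rec; apply: nrec => W xW.
  have [t [h1 h2 h3]] := rec W xW; exists t; split => // k.
  have [_ low] := hPsi (Num.truncn (energy x)).+1%:R; have [_ _ h] := low x xn.
  have [x0 hx _] := Phi_flow x.
  by rewrite (h _ hx x0).
apply: lebesgue_outer_bigcup0 => n; have [K0 Kh] := hK n%:R.
have [fl low] := hPsi n%:R; apply: (truncated_recurrence K0 Kh fl) => x t xn.
by have [] := low x xn.
Qed.

End SeparableHamiltonian.

(** * Reparametrization by gradient flows *)

Lemma derive_gt0_lt (R : realType) (h dh : R -> R) (a b : R) : a < b ->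
  (forall t : R, is_derive t (1 : R) h (dh t)) -> (forall t, 0 < dh t) -> h a < h b.
Proof.
move=> ab hd dh0; have [|x _ e] := MVT ab (fun t _ => hd t).
  by apply: continuous_subspaceT; exact: is_derive_continuous hd.
by rewrite -subr_gt0 e mulr_gt0// subr_gt0.
Qed.

Lemma derive_neq0_inj (R : realType) (h dh : R -> R) :
  (forall t : R, is_derive t (1 : R) h (dh t)) -> (forall t, dh t != 0) -> injective h.
Proof.
move=> hd dh0.
have lt_neq a b : a < b -> h a <> h b.
  move=> ab hab; have [|x _ e] := MVT ab (fun t _ => hd t).
    by apply: continuous_subspaceT; exact: is_derive_continuous hd.
  move/eqP: e; rewrite hab subrr eq_sym mulf_eq0 (negbTE (dh0 x)) subr_eq0 /=.
  by rewrite gt_eqF.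
move=> a b hab; have [ab|ba|//] := ltgtP a b.
  by case: (lt_neq _ _ ab).
by case: (lt_neq _ _ ba).
Qed.

(** The inverse of a complete solution of [y' = w y] is the travel time, the
    antiderivative of [1 / w]: this function is injective because its derivative
    never vanishes, and onto because the solution is complete. *)
Lemma travel_time (R : realType) (w gam : R -> R) : continuous w ->
  (forall t, w t != 0) -> (forall s : R, is_derive s (1 : R) gam (w (gam s))) ->
  exists del : R -> R, [/\ forall t : R, is_derive t (1 : R) del (w t)^-1,
    cancel gam del & cancel del gam].
Proof.
move=> cw w0 hgam.
have [|del [del0 hdel]] := @antiderivative_at R (fun t => (w t)^-1) (gam 0).
  by move=> t; apply: continuousV; [exact: w0 | exact: cw].
(* [del \o gam] has derivative 1. *)
have gamK : cancel gam del.
  have h (s : R) : is_derive s (1 : R) (del \o gam) 1.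
    by have := is_derive1_comp (hdel (gam s)) (hgam s); rewrite mulVf.
  have hid (s : R) : is_derive s (1 : R) (id : R -> R) 1 by exact: is_derive_id.
  move=> s; have [s0|/ltW s0] := leP 0 s.
    by have := derive_eq_sub s0 (fun r _ => h r) (fun r _ => hid r);
      rewrite /= del0 !subr0.
  by have := derive_eq_sub s0 (fun r _ => h r) (fun r _ => hid r);
    rewrite /= del0 !sub0r => /oppr_inj.
exists del; split => // t; apply: (derive_neq0_inj hdel) => [r|].
  by rewrite invr_eq0.
by rewrite gamK.
Qed.

Section ChangeOfCoordinates.
Context {R : realType} {d : nat} (J : 'M[R]_d).
Variables (F w gam : 'I_d -> R -> R) (p : 'I_d -> R).
Hypothesis d_gt0 : (0 < d)%N.
Hypothesis J_skew : skew J.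
Hypothesis F_derive : forall k (t : R), is_derive t (1 : R) (F k) (w k t).
Hypothesis w_continuous : forall k, continuous (w k).
Hypothesis w_neq0 : forall k t, w k t != 0.
Hypothesis gam_derive : forall k (s : R),
  is_derive s (1 : R) (gam k) (w k (gam k s)).
Hypothesis p_range : forall k, exists y, F k y = p k.
Local Notation point := 'rV[R]_d.

Definition gradient_field (y : point) : point :=
  \row_k (w k (y 0 k) * \sum_l J k l * (F l (y 0 l) - p l)).

Let c l s := F l (gam l s) - p l.
Let G (x : point) : point := \row_k gam k (x 0 k).

Lemma reparametrized_derive l (s : R) :
  is_derive s (1 : R) (c l) (w l (gam l s) * w l (gam l s)).
Proof.
have h := is_derive1_comp (F_derive l (gam l s)) (gam_derive l s).
have := is_deriveB h (is_derive_cst (p l) s (1 : R)).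
by rewrite subr0.
Qed.

Lemma gam_continuous l : continuous (gam l).
Proof. exact: is_derive_continuous (gam_derive l). Qed.

Lemma w_gam_continuous l : continuous (fun s => w l (gam l s)).
Proof.
move=> s; apply: (@continuous_comp _ _ _ (gam l) (w l)).
  exact: gam_continuous.
exact: w_continuous.
Qed.

Lemma coordinates_lip (K : R) : exists2 L, 0 < L & forall k s t,
  `|s| <= K -> `|t| <= K -> `|gam k s - gam k t| <= L * `|s - t|.
Proof.
have [L L0 hL] : exists2 L, 0 <= L & forall k, forall s t, `|s| <= K -> `|t| <= K ->
    `|gam k s - gam k t| <= L * `|s - t|.
  apply: uniform_bound => k.
  have [L L0 hL] := C1_locally_lipschitz (gam_derive k) (@w_gam_continuous k) K.
  exists L => [|L' LL' s t sK tK]; first exact: ltW.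
  by apply: le_trans (hL _ _ sK tK) _; rewrite ler_wpM2r.
exists (L + 1) => [|k s t sK tK]; first by rewrite ltr_wpDl.
by apply: le_trans (hL k s t sK tK) _; rewrite ler_wpM2r// lerDl.
Qed.

Lemma coordinates_continuous : continuous G.
Proof.
move=> x; have [L L0 hL] := coordinates_lip (`|x| + 1).
apply: continuous_at_dist => e e0; near=> y.
have xy : `|x - y| <= Num.min 1 (L^-1 * e).
  near: y; apply: near_dist_le_row.
  by rewrite lt_min ltr01 mulr_gt0// invr_gt0.
move: xy; rewrite le_min => /andP[xy1 xy].
have yx : `|y| <= `|x| + 1.
  have -> : y = x - (x - y) by rewrite opprB addrC subrK.
  by apply: le_trans (ler_normB _ _) _; rewrite lerD2l.
apply: norm_le_coord => [|k]; first exact: ltW.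
rewrite !mxE; apply: le_trans (hL k _ _ _ _) _.
- by apply: le_trans (le_coord_norm x k) _; rewrite lerDl.
- exact: le_trans (le_coord_norm y k) _.
- rewrite -ler_pdivlMl//; apply: le_trans xy.
  by have := le_coord_norm (x - y) k; rewrite !mxE.
Unshelve. all: by end_near. Qed.

(** The coordinate change is only locally Lipschitz: it is Lipschitz after clamping,
    which changes nothing on the cubes that exhaust the space. *)
Lemma coordinates_null A : lebesgue_outer A = 0%E -> lebesgue_outer (G @` A) = 0%E.
Proof.
move=> A0; apply: (@lebesgue_outer_sub0 _ _ _
    (\bigcup_(n : nat) G @` (A `&` [set x | `|x| <= n%:R]))).
  move=> _ [x Ax <-]; exists (Num.truncn `|x|).+1 => //; exists x => //; split => //=.
  by apply: ltW; exact: truncnS_gt.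
apply: lebesgue_outer_bigcup0 => n; have [L L0 hL] := coordinates_lip n%:R.
pose h k s := gam k (clamp n%:R s).
have h_lip k s t : `|h k s - h k t| <= L * `|s - t|.
  apply: le_trans (hL _ _ _ (clamp_le (ler0n _ n) s) (clamp_le (ler0n _ n) t)) _.
  by rewrite ler_pM2l// clamp_lip.
have := lebesgue_outer_coordinatewise d_gt0 L0 h_lip
  (lebesgue_outer_sub0 (@subIsetl _ A [set x | `|x| <= n%:R]) A0).
apply: lebesgue_outer_sub0 => _ [x [Ax xn] <-]; exists x => //.
apply/rowP => k; rewrite !mxE /h clamp_id//.
exact: le_trans (le_coord_norm x k) _.
Qed.

(** In the time parameter of the gradient orbits the factors [w k] disappear, the
    forces become the increasing functions [F l \o gam l - p l], and the system
    is a separable Hamiltonian one. Both the flow and null sets are transported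
    back by the coordinate change. *)
Theorem gradient_field_recurrence : has_poincare_recurrent_flow gradient_field.
Proof.
have /choice[del hdel] : forall k, exists del : R -> R,
    [/\ forall t : R, is_derive t (1 : R) del (w k t)^-1,
      cancel (gam k) del & cancel del (gam k)].
  by move=> k; apply: travel_time => //; exact: w_continuous.
pose G' (y : point) : point := \row_k del k (y 0 k).
have GK y : G (G' y) = y.
  by apply/rowP => k; rewrite !mxE; have [_ _ ->] := hdel k.
have G'K x : G' (G x) = x.
  by apply/rowP => k; rewrite !mxE; have [_ -> _] := hdel k.
have c_incr l s t : s < t -> c l s < c l t.
  move=> st; apply: (derive_gt0_lt st (reparametrized_derive l)) => r.
  by rewrite -expr2 exprn_even_gt0//= w_neq0.
have c_lip l : locally_lipschitz (c l).
  apply: C1_locally_lipschitz (reparametrized_derive l) _ => s.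
  by apply: continuousM; exact: w_gam_continuous.
have /choice[z c_z] : forall l, exists z, c l z = 0.
  move=> l; have [y hy] := p_range l; exists (del l y).
  by have [_ _ K] := hdel l; rewrite /c K hy subrr.
have /choice[C hC] : forall l, exists F : R -> R, F (z l) = 0 /\
    forall t : R, is_derive t (1 : R) F (c l t).
  move=> l; apply: antiderivative_at.
  exact: is_derive_continuous (reparametrized_derive l).
have [Psi hPsi nPsi] := @separable_hamiltonian_recurrence _ _ J c z d_gt0 J_skew
  c_lip c_incr c_z C (fun l => (hC l).2) (fun l => (hC l).1).
pose Phi y t := G (Psi (G' y) t).
have fieldE x k : gradient_field (G x) 0 k =
    w k (gam k (x 0 k)) * hamiltonian_field J c x 0 k.
  rewrite !mxE; congr (_ * _); apply: eq_bigr => l _; by rewrite mxE.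
have Phi_flow : is_flow gradient_field Phi.
  move=> y; have [x0 hx ux] := hPsi (G' y); split.
  - by rewrite /Phi x0 GK.
  - move=> t; apply/is_derive_rowP => k; rewrite fieldE.
    have h := (is_derive_rowP _ _ _).1 (hx t) k.
    have := is_derive1_comp (gam_derive k (Psi (G' y) t 0 k)) h.
    by congr (is_derive _ _ _ _); apply/funext => s; rewrite mxE.
  - move=> u hu u0 t; rewrite -[LHS]GK; congr G.
    apply: (ux (G' \o u)) => [s|]; last by rewrite /= u0.
    apply/is_derive_rowP => k.
    have h := (is_derive_rowP _ _ _).1 (hu s) k.
    have [dk _ _] := hdel k.
    have := is_derive1_comp (dk (u s 0 k)) h.
    have -> : (w k (u s 0 k))^-1 * gradient_field (u s) 0 k =
        hamiltonian_field J c ((G' \o u) s) 0 k.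
      rewrite -{2}[u s]GK fieldE -{1}[u s]GK mxE mulrA mulVf ?mul1r//.
    by congr (is_derive _ _ _ _); apply/funext => r; rewrite mxE.
exists Phi => //; apply: lebesgue_outer_sub0 (coordinates_null nPsi) => y nrec.
exists (G' y); last exact: GK.
move=> /= rec; apply: nrec => W yW.
have /rec[t [h1 h2 h3]] : nbhs (G' y) (G @^-1` W).
  by apply: coordinates_continuous; rewrite GK.
by exists t.
Qed.

End ChangeOfCoordinates.

(** * Parametrizations of one real variable *)

Section OneDimension.
Context {R : realType}.
Implicit Types (h : 'rV[R]_1 -> R) (t : R).

Lemma row1E (x : 'rV[R]_1) : x = const_mx (x 0 0).
Proof. by apply/rowP => k; rewrite !mxE ord1. Qed.

Lemma quotient_row1 h t :
  (fun s : R => s^-1 *: ((h \o shift (const_mx t)) (s *: delta_mx 0 0) -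
     h (const_mx t))) =
  (fun s : R => s^-1 *: (((fun r => h (const_mx r)) \o shift t) (s *: 1) -
     h (const_mx t))).
Proof.
apply/funext => s /=; congr (_ *: (h _ - _)); apply/rowP => k.
by rewrite !mxE !ord1 eqxx mulr1 /GRing.scale /= mulr1.
Qed.

Lemma derivable_row1 h t :
  derivable h (const_mx t) (delta_mx 0 0) <-> derivable (fun s => h (const_mx s)) t 1.
Proof. by rewrite /derivable quotient_row1. Qed.

Lemma grad_row1 h t : grad h (const_mx t) 0 0 = 'D_1 (fun s => h (const_mx s)) t.
Proof. by rewrite mxE /derive quotient_row1. Qed.

Lemma is_derive_row1 h t : derivable h (const_mx t) (delta_mx 0 0) ->
  is_derive t (1 : R) (fun s => h (const_mx s)) (grad h (const_mx t) 0 0).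
Proof. by move=> /derivable_row1 hd; rewrite grad_row1; exact: DeriveDef. Qed.

Lemma const_row1_continuous : continuous (fun t => const_mx t : 'rV[R]_1).
Proof.
move=> t; apply: (@is_derive_continuous _ _ _ (fun=> const_mx 1 : 'rV[R]_1)) => s.
apply/is_derive_rowP => k; rewrite mxE.
have -> : (fun s : R => (const_mx s : 'rV[R]_1) 0 k) = id.
  by apply/funext => r; rewrite mxE.
exact: is_derive_id.
Qed.

(** What the dynamics require of a one-dimensional parametrization [h] of a
    strategy weight with equilibrium value [v]: it is of class C1 without
    critical point, its gradient flow has a complete orbit, and it takes the
    value [v]. *)
Definition admissible h (v : R) : Prop :=
  [/\ forall t, derivable h (const_mx t) (delta_mx 0 0),
      continuous (fun t => grad h (const_mx t) 0 0),
      forall t, grad h (const_mx t) 0 0 != 0,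
      exists gam : R -> R, forall s : R,
        is_derive s (1 : R) gam (grad h (const_mx (gam s)) 0 0) &
      exists y, h (const_mx y) = v].

Lemma smooth_admissible h v : smooth h -> ascent_complete h ->
  (forall x, grad h x <> 0) -> (exists x, h x = v) -> admissible h v.
Proof.
move=> sm compl g0 [x hx]; have [_ /(_ 0)[hd [cd _]]] := sm 1%N.
split.
- by move=> t; exact: hd.
- have -> : (fun t => grad h (const_mx t) 0 0) =
      (fun t => 'D_(delta_mx 0 0) h (const_mx t)).
    by apply/funext => t; rewrite mxE.
  move=> t; apply: (@continuous_comp _ _ _ (fun t => const_mx t : 'rV[R]_1)
    (fun x => 'D_(delta_mx 0 0) h x)); last exact: cd.
  exact: const_row1_continuous.
- move=> t; apply/eqP => e; apply: (g0 (const_mx t)).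
  by rewrite (row1E (grad _ _)) e; apply/rowP => k; rewrite !mxE.
- have [gam hgam _] := compl 0; exists (fun s => gam s 0 0) => s.
  by rewrite -row1E; exact: (is_derive_rowP _ _ _).1 (hgam s) 0.
- by exists (x 0 0); rewrite -row1E.
Qed.

Lemma sigmoid_gt0 t : 0 < sigmoid t.
Proof. by rewrite invr_gt0 addr_gt0// expR_gt0. Qed.

Lemma sigmoid_lt1 t : sigmoid t < 1.
Proof. by rewrite invf_lt1 ?addr_gt0 ?expR_gt0// ltrDl expR_gt0. Qed.

Lemma is_derive_sigmoid t :
  is_derive t (1 : R) sigmoid (sigmoid t * (1 - sigmoid t)).
Proof.
have d0 : 1 + expR (- t) != 0 by rewrite gt_eqF// addr_gt0// expR_gt0.
have dN : is_derive t (1 : R) (fun s => - s) (-1).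
  exact: (is_deriveN (is_derive_id t (1 : R))).
have h1 := is_derive1_comp (is_derive_expR (- t)) dN.
have h2 := is_deriveD (is_derive_cst (1 : R) t (1 : R)) h1.
have := @is_deriveV R (fun s : R => 1 + expR (- s)) t _ 1 d0 h2.
have -> : - (1 + expR (- t)) ^- 2 *: (0 + expR (- t) * -1) =
    sigmoid t * (1 - sigmoid t).
  by rewrite /sigmoid /GRing.scale /=; field.
by [].
Qed.

Lemma sigmoid_admissible v : 0 < v < 1 -> admissible sigmoid_rV v.
Proof.
move=> /andP[v0 v1].
have hS (t : R) : is_derive t (1 : R) (fun s => sigmoid_rV (const_mx s : 'rV[R]_1))
    (sigmoid t * (1 - sigmoid t)).
  have -> : (fun s => sigmoid_rV (const_mx s : 'rV[R]_1)) = sigmoid.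
    by apply/funext => s; rewrite /sigmoid_rV mxE.
  exact: is_derive_sigmoid.
have gE t : grad sigmoid_rV (const_mx t : 'rV[R]_1) 0 0 = sigmoid t * (1 - sigmoid t).
  by rewrite grad_row1; have [] := hS t.
have s01 (t : R) := (sigmoid_gt0 t, sigmoid_lt1 t).
have lip s t : `|sigmoid s * (1 - sigmoid s) - sigmoid t * (1 - sigmoid t)| <=
    `|s - t| :> R.
  have key a b : a <= b -> `|sigmoid b - sigmoid a| <= b - a :> R.
    move=> ab; apply: (@derive_le_dist R sigmoid _ id (fun=> 1) a b ab
      (fun r _ => is_derive_sigmoid r)) => r _; have [r0 r1] := s01 r.
    by rewrite ger0_norm; nra.
  have key' : `|sigmoid s - sigmoid t| <= `|s - t| :> R.
    have [/ltW st|ts] := ltP s t.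
      by rewrite distrC [leRHS]distrC [leRHS]ger0_norm ?subr_ge0//; exact: key.
    by rewrite [leRHS]ger0_norm ?subr_ge0//; exact: key.
  apply: le_trans key'.
  have -> : sigmoid s * (1 - sigmoid s) - sigmoid t * (1 - sigmoid t) =
    (sigmoid s - sigmoid t) * (1 - sigmoid s - sigmoid t) by ring.
  rewrite normrM ler_piMr// ler_norml.
  by have [? ?] := s01 s; have [? ?] := s01 t; apply/andP; split; lra.
pose V (x : 'rV[R]_1) : 'rV[R]_1 :=
  const_mx (sigmoid (x 0 0) * (1 - sigmoid (x 0 0))).
have V_lip x y : `|V x - V y| <= 1 * `|x - y|.
  rewrite mul1r; apply: norm_le_coord => // k; rewrite !mxE.
  apply: le_trans (lip _ _) _.
  by have := le_coord_norm (x - y) 0; rewrite !mxE.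
have [gam hgam _] := picard ltr01 V_lip 0.
split.
- by move=> t; apply/derivable_row1; have [] := hS t.
- have -> : (fun t => grad sigmoid_rV (const_mx t : 'rV[R]_1) 0 0) =
      (fun t => sigmoid t * (1 - sigmoid t)).
    by apply/funext.
  move=> t; have cs : continuous (sigmoid : R -> R).
    exact: is_derive_continuous is_derive_sigmoid.
  apply: continuousM; first exact: cs.
  by apply: continuousB; [exact: cst_continuous | exact: cs].
- by move=> t; rewrite gE mulf_neq0// gt_eqF ?subr_gt0//; have [] := s01 t.
- exists (fun s => gam s 0 0) => s; rewrite gE.
  by have := (is_derive_rowP _ _ _).1 (hgam s) 0; rewrite mxE.
- exists (- ln (v^-1 - 1)); rewrite /sigmoid_rV mxE /sigmoid opprK lnK.
    by rewrite addrC subrK invrK.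
  by rewrite posrE subr_gt0 invf_gt1.
Qed.

(** A continuous injection into the line has at most one variable: along a path
    from a point to its antipode that avoids the origin, the difference of the
    values at antipodal points changes sign. *)
Lemma continuous_injective_dim (k : nat) (f : 'rV[R]_k -> R) :
  continuous f -> injective f -> (k <= 1)%N.
Proof.
move=> cf inj; rewrite leqNgt; apply/negP => k2.
pose i0 := Ordinal (ltnW k2); pose i1 := Ordinal k2.
pose a (t : R) : 'rV[R]_k :=
  (1 - 2 * t) *: delta_mx 0 i0 + (t * (1 - t)) *: delta_mx 0 i1.
have ca : continuous a.
  have cp (P : {poly R}) j : continuous (fun t : R => P.[t] *: delta_mx 0 j : 'rV[R]_k).
    by move=> t; apply: continuousZr_tmp; exact: continuous_horner.
  have -> : a = (fun t => (1 - 2 *: 'X).[t] *: delta_mx 0 i0) +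
                (fun t => ('X * (1 - 'X)).[t] *: delta_mx 0 i1).
    by apply/funext => t; rewrite !fctE !hornerE.
  by move=> t; apply: continuousD; exact: cp.
have cNa : continuous (fun t => - a t) by move=> t; apply: continuousN; exact: ca.
pose h t := f (a t) - f (- a t).
have ch : continuous h.
  move=> t; apply: continuousB.
    by apply: continuous_comp; [exact: ca | exact: cf].
  by apply: (@continuous_comp _ _ _ (fun t => - a t) f); [exact: cNa | exact: cf].
have a1 : a 1 = - a 0.
  by apply/rowP => j; rewrite /a !mxE; ring.
have h1 : h 1 = - h 0 by rewrite /h a1 opprK opprB.
have [||c _ hc] := @IVT R h 0 1 0 ler01.
- by apply: continuous_subspaceT; exact: ch.
- rewrite h1 ge_min le_max !oppr_ge0 oppr_le0 orbC.
  by have [|/ltW] := leP 0 (h 0); rewrite ?orbT// => -> .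
have /inj ac : f (a c) = f (- a c) by apply/eqP; rewrite -subr_eq0; apply/eqP.
have ac0 j : a c 0 j = 0.
  by have := congr1 (fun x : 'rV[R]_k => x 0 j) ac; rewrite [in RHS]mxE; lra.
have := ac0 i0; have := ac0 i1; rewrite !mxE !eqxx /=.
rewrite !mulr1 !mulr0 addr0 add0r; clear => e1 e2.
have c2 : c = 2^-1 by lra.
by move: e1; rewrite c2; lra.
Qed.

End OneDimension.

(** * Nash equilibria and the gradient descent-ascent field *)

Section Nash.
Context {R : realType} {N M : nat} (U : 'M[R]_(N, M)) (p : 'cV[R]_N) (q : 'cV[R]_M).

Lemma payoffE (x : 'cV[R]_N) (y : 'cV[R]_M) :
  payoff U x y = \sum_i x i 0 * (\sum_j U i j * y j 0).
Proof.
rewrite /payoff -mulmxA mxE; apply: eq_bigr => i _.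
by rewrite !mxE.
Qed.

Lemma payoffE_col (x : 'cV[R]_N) (y : 'cV[R]_M) :
  payoff U x y = \sum_j (\sum_i U i j * x i 0) * y j 0.
Proof.
rewrite /payoff mxE; apply: eq_bigr => j _; rewrite mxE; congr (_ * _).
by apply: eq_bigr => i _; rewrite mxE mulrC.
Qed.

Lemma sum_delta_col (k : nat) (i : 'I_k) (a : 'I_k -> R) :
  \sum_l (delta_mx i 0 : 'cV[R]_k) l 0 * a l = a i.
Proof.
rewrite (bigD1 i)//= big1 => [|l /negbTE li]; last by rewrite mxE li mul0r.
by rewrite mxE !eqxx mul1r addr0.
Qed.

Lemma probability_delta (k : nat) (i : 'I_k) :
  probability_vector (delta_mx i 0 : 'cV[R]_k).
Proof.
split=> [l|]; first by rewrite mxE ler0n.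
by have := sum_delta_col i (fun=> 1); under eq_bigr do rewrite mulr1.
Qed.

(** The terms [x_i * (a_i - v)] are nonnegative and add up to zero. *)
Lemma equalizing (k : nat) (x : 'cV[R]_k) (a : 'I_k -> R) (v : R) :
  (forall i, 0 < x i 0) -> \sum_i x i 0 = 1 -> \sum_i x i 0 * a i = v ->
  (forall i, v <= a i) -> forall i, a i = v.
Proof.
move=> x0 x1 xa va i.
have z : \sum_i x i 0 * (a i - v) = 0.
  under eq_bigr do rewrite mulrBr.
  by rewrite sumrB -big_distrl /= x1 xa mul1r subrr.
have := z; move/eqP; rewrite psumr_eq0 => [/allP/(_ i)|l _]; last first.
  by rewrite mulr_ge0 ?subr_ge0// ltW.
rewrite mem_index_enum mulf_eq0 gt_eqF//= subr_eq0 => /(_ isT)/eqP->.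
by [].
Qed.

Hypothesis nash : fully_mixed_nash U p q.

(** Otherwise the minimizer, who uses every row with positive weight, could do
    better with a pure strategy. *)
Lemma nash_row i : \sum_j U i j * q j 0 = payoff U p q.
Proof.
have [[[_ p1] _] [p0 _] min _] := nash.
apply: (equalizing (x := p) (a := fun i => \sum_j U i j * q j 0)) => //.
  by rewrite payoffE.
move=> l; have := min _ (probability_delta l).
by rewrite [in X in _ -> X](payoffE p) (payoffE (delta_mx _ _)) sum_delta_col -payoffE.
Qed.

Lemma nash_col j : \sum_i U i j * p i 0 = payoff U p q.
Proof.
have [[_ [_ q1]] [_ q0] _ max] := nash; apply: oppr_inj.
apply: (equalizing (x := q) (a := fun j => - \sum_i U i j * p i 0)) => //.
  rewrite payoffE_col -sumrN; apply: eq_bigr => l _; ring.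
move=> l; have := max _ (probability_delta l).
rewrite lerN2; congr (_ <= _); rewrite payoffE_col.
by under eq_bigr do rewrite mulrC; rewrite sum_delta_col.
Qed.

Lemma nash_lt1 : (2 <= N)%N -> forall i, 0 < p i 0 < 1.
Proof.
move=> N2 i; have [[[_ p1] _] [p0 _] _ _] := nash; rewrite p0 /=.
have [i' ii'] : exists i' : 'I_N, i' != i.
  have [e|ne] := eqVneq (i : nat) 0%N.
    by exists (Ordinal N2); rewrite -val_eqE /= e.
  by exists (Ordinal (ltnW N2)); rewrite -val_eqE /= eq_sym.
rewrite -p1 (bigD1 i)//= ltrDl (bigD1 i')//=.
by rewrite ltr_wpDr//; apply: sumr_ge0 => l _; exact: ltW.
Qed.

End Nash.

(** Exchanging the players turns maximization into minimization of the opposite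
    payoff; this carries facts about the row player over to the column player. *)
Lemma nash_swap (R : realType) (N M : nat) (U : 'M[R]_(N, M)) p q :
  fully_mixed_nash U p q -> fully_mixed_nash (- U^T) q p.
Proof.
have E x y : payoff (- U^T) x y = - payoff U y x.
  rewrite payoffE payoffE_col -sumrN; apply: eq_bigr => i _.
  rewrite mulrC -mulNr; congr (_ * _); rewrite -sumrN; apply: eq_bigr => j _.
  by rewrite !mxE mulNr.
move=> [[pp qq] [p0 q0] min max]; split => // [x xx|y yy]; rewrite !E lerN2.
- exact: max.
- exact: min.
Qed.

Section OneDimensionalGame.
Context {R : realType} {N M : nat} (U : 'M[R]_(N, M)) (p : 'cV[R]_N) (q : 'cV[R]_M).
Variables (f : 'I_N -> 'rV[R]_1 -> R) (g : 'I_M -> 'rV[R]_1 -> R).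
Hypothesis nash : fully_mixed_nash U p q.
Hypothesis f_admissible : forall i, admissible (f i) (p i 0).
Hypothesis g_admissible : forall j, admissible (g j) (q j 0).

Local Notation n := (fun _ : 'I_N => 1%N).
Local Notation m := (fun _ : 'I_M => 1%N).
Local Notation dim := (\sum_i n i + \sum_j m j + (1 + 1))%N.

(** The variables of the system: [inl (inl i)] is [theta_i], [inl (inr j)] is
    [phi_j], [inr true] is [lambda] and [inr false] is [mu]. *)
Local Notation var := ('I_N + 'I_M + bool)%type.

Definition var_index (k : var) : 'I_dim :=
  match k with
  | inl (inl i) => lshift _ (lshift _ (tagnat.Rank (p_ := n) i ord0))
  | inl (inr j) => lshift _ (rshift _ (tagnat.Rank (p_ := m) j ord0))
  | inr true => rshift _ (lshift 1 ord0)
  | inr false => rshift _ (rshift 1 ord0)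
  end.

Definition index_var (k : 'I_dim) : var :=
  match fintype.split k with
  | inl a => inl (match fintype.split a with
                  | inl i => inl (tagnat.sig1 i)
                  | inr j => inr (tagnat.sig1 j)
                  end)
  | inr b => inr (if fintype.split b is inl _ then true else false)
  end.

Lemma var_indexK : cancel var_index index_var.
Proof.
rewrite /index_var; case=> [[i|j]|[|]] /=.
- by rewrite (unsplitK (inl _)) (unsplitK (inl _)) tagnat.Rank1K.
- by rewrite (unsplitK (inl _)) (unsplitK (inr _)) tagnat.Rank1K.
- by rewrite (unsplitK (inr _)) (unsplitK (inl _)).
- by rewrite (unsplitK (inr _)) (unsplitK (inr _)).
Qed.

Lemma index_varK : cancel index_var var_index.
Proof.
move=> k; rewrite /index_var -[RHS]splitK; case: fintype.split => a /=; last first.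
  by rewrite -[in RHS](splitK a); case: fintype.split => b /=; rewrite (ord1 b).
by rewrite -[in RHS](splitK a); case: fintype.split => b /=;
  rewrite -[in RHS](tagnat.sig2K b) (ord1 (tagnat.sig2 b)).
Qed.

Lemma sum_index_var (h : var -> R) : \sum_k h (index_var k) =
  \sum_i h (inl (inl i)) + \sum_j h (inl (inr j)) + (h (inr true) + h (inr false)).
Proof.
rewrite (reindex var_index) /=; last first.
  by apply: onW_bij; exists index_var; [exact: var_indexK | exact: index_varK].
rewrite (eq_bigr h) => [|k _]; last by rewrite var_indexK.
by rewrite big_sumType /= big_sumType big_bool.
Qed.

Lemma mk_state_var (th : 'I_N -> 'rV[R]_1) (ph : 'I_M -> 'rV[R]_1) la mu k :
  mk_state (n := n) (m := m) th ph la mu 0 (var_index k) =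
  match k with
  | inl (inl i) => th i 0 0
  | inl (inr j) => ph j 0 0
  | inr true => la
  | inr false => mu
  end.
Proof.
rewrite /mk_state; case: k => [[i|j]|[|]] /=.
- rewrite !row_mxEl -[in RHS](mxrowK (q_ := n) th i) [in RHS]mxE.
  by congr (_ _ _); exact: ord1.
- rewrite row_mxEl row_mxEr -[in RHS](mxrowK (q_ := m) ph j) [in RHS]mxE.
  by congr (_ _ _); exact: ord1.
- by rewrite row_mxEr row_mxEl mxE.
- by rewrite !row_mxEr mxE.
Qed.

Lemma theta_of_var (x : 'rV[R]_dim) i :
  theta_of (n := n) (m := m) x i = const_mx (x 0 (var_index (inl (inl i)))).
Proof. by apply/rowP => k; rewrite ord1 !mxE. Qed.

Lemma phi_of_var (x : 'rV[R]_dim) j :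
  phi_of (n := n) (m := m) x j = const_mx (x 0 (var_index (inl (inr j)))).
Proof. by apply/rowP => k; rewrite ord1 !mxE. Qed.

Lemma lambda_of_var (x : 'rV[R]_dim) :
  lambda_of (n := n) (m := m) x = x 0 (var_index (inr true)).
Proof. by rewrite /lambda_of !mxE. Qed.

Lemma mu_of_var (x : 'rV[R]_dim) :
  mu_of (n := n) (m := m) x = x 0 (var_index (inr false)).
Proof. by rewrite /mu_of !mxE. Qed.

Definition var_weight (k : var) (t : R) : R :=
  match k with
  | inl (inl i) => f i (const_mx t)
  | inl (inr j) => g j (const_mx t)
  | inr _ => t
  end.

Definition var_slope (k : var) (t : R) : R :=
  match k with
  | inl (inl i) => grad (f i) (const_mx t) 0 0
  | inl (inr j) => grad (g j) (const_mx t) 0 0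
  | inr _ => 1
  end.

(** At the equilibrium both multipliers equal minus the value of the game. *)
Definition var_equilibrium (k : var) : R :=
  match k with
  | inl (inl i) => p i 0
  | inl (inr j) => q j 0
  | inr _ => - payoff U p q
  end.

Definition var_coupling (k l : var) : R :=
  match k, l with
  | inl (inl i), inl (inr j) => - U i j
  | inl (inr j), inl (inl i) => U i j
  | inl (inl _), inr true => -1
  | inr true, inl (inl _) => 1
  | inl (inr _), inr false => 1
  | inr false, inl (inr _) => -1
  | _, _ => 0
  end.

Definition coupling : 'M[R]_dim :=
  \matrix_(k, l) var_coupling (index_var k) (index_var l).

Lemma coupling_skew : skew coupling.
Proof.
by move=> k l; rewrite !mxE; case: (index_var k) => [[i|j]|[|]];
  case: (index_var l) => [[i'|j']|[|]] /=; rewrite ?oppr0 ?opprK.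
Qed.

(** The gradient descent-ascent field in the form of a separable Hamiltonian
    system: subtracting the equilibrium values costs nothing, because every
    pure strategy is optimal against a fully mixed equilibrium. *)
Lemma gda_field_gradient_form :
  gda_field (n := n) (m := m) U f g =
  gradient_field coupling (fun k => var_weight (index_var k))
    (fun k => var_slope (index_var k)) (fun k => var_equilibrium (index_var k)).
Proof.
apply/funext => x; apply/rowP => k; rewrite -(index_varK k).
set v := index_var k; rewrite mk_state_var mxE var_indexK.
pose h u := var_coupling v u *
  (var_weight u (x 0 (var_index u)) - var_equilibrium u).
rewrite [X in _ * X](eq_bigr (fun l => h (index_var l))) => [|l _]; last first.
  by rewrite /h mxE var_indexK index_varK.
rewrite sum_index_var /h {h}.
have [[[_ p1] [_ q1]] _ _ _] := nash.
case: v => [[i|j]|[|]] /=.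
- rewrite !mxE theta_of_var lambda_of_var mulrC; congr (_ * _).
  rewrite [X in _ = X + _ + _]big1 => [|l _]; last by rewrite mul0r.
  have <- : \sum_j U i j * q j 0 = payoff U p q := nash_row nash i.
  under eq_bigr do rewrite phi_of_var.
  under [X in _ = _ + X + _]eq_bigr do rewrite mulNr mulrBr.
  by rewrite sumrN sumrB; ring.
- rewrite !mxE phi_of_var mu_of_var mulrC; congr (_ * _).
  rewrite [X in _ = _ + X + _]big1 => [|l _]; last by rewrite mul0r.
  have <- : \sum_i U i j * p i 0 = payoff U p q := nash_col nash j.
  under eq_bigr do rewrite theta_of_var.
  under [X in _ = X + _ + _]eq_bigr do rewrite mulrBr.
  by rewrite sumrB; ring.
- rewrite mul1r [X in _ = _ + X + _]big1 => [|l _]; last by rewrite mul0r.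
  under eq_bigr do rewrite theta_of_var.
  under [X in _ = X + _ + _]eq_bigr do rewrite mul1r.
  by rewrite sumrB p1; ring.
- rewrite mul1r [X in _ = X + _ + _]big1 => [|l _]; last by rewrite mul0r.
  under eq_bigr do rewrite phi_of_var.
  under [X in _ = _ + X + _]eq_bigr do rewrite mulN1r.
  by rewrite sumrN sumrB q1; ring.
Qed.

Lemma one_dimensional_recurrence :
  has_poincare_recurrent_flow (gda_field (n := n) (m := m) U f g).
Proof.
have /choice[gam hgam] : forall k : var, exists gam : R -> R, forall s : R,
    is_derive s (1 : R) gam (var_slope k (gam s)).
  case=> [[i|j]|b].
  - by have [_ _ _] := f_admissible i.
  - by have [_ _ _] := g_admissible j.
  - by exists id => s; exact: is_derive_id.
rewrite gda_field_gradient_form.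
have dim_gt0 : (0 < dim)%N by rewrite addn_gt0 orbT.
apply: (@gradient_field_recurrence R dim coupling
  (fun k => var_weight (index_var k)) (fun k => var_slope (index_var k))
  (fun k => gam (index_var k)) (fun k => var_equilibrium (index_var k))
  dim_gt0 coupling_skew) => [k t|k|k t|k].
- case: (index_var k) => [[i|j]|b] /=.
  + by apply: is_derive_row1; have [] := f_admissible i.
  + by apply: is_derive_row1; have [] := g_admissible j.
  + exact: is_derive_id.
- case: (index_var k) => [[i|j]|b].
  + by have [] := f_admissible i.
  + by have [] := g_admissible j.
  + by move=> t; exact: cst_continuous.
- case: (index_var k) => [[i|j]|b] /=.
  + by have [] := f_admissible i.
  + by have [] := g_admissible j.
  + exact: oner_neq0.
- case: (index_var k) => [[i|j]|b] /=.
  + by have [] := f_admissible i.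
  + by have [] := g_admissible j.
  + by exists (- payoff U p q).
Qed.

End OneDimensionalGame.

(** Without variables the gradient would vanish, and two variables leave no room
    for an injection. *)
Lemma safe_smooth_dim (R : realType) (k : nat) (h : 'rV[R]_k -> R) :
  smooth h -> injective h -> grad h 0 <> 0 -> k = 1%N.
Proof.
move=> sm inj g0; have [ch _] := sm 0%N.
have := continuous_injective_dim ch inj.
case: k h sm inj g0 ch => [|[|//]] h _ _ g0 _ _ //.
by case: g0; exact: thinmx0.
Qed.

(** * Recurrence of gradient descent-ascent *)

Theorem theorem7 (R : realType) (N M : nat) (hN : (2 <= N)%N) (hM : (2 <= M)%N)
    (U : 'M[R]_(N, M)) (p : 'cV[R]_N) (q : 'cV[R]_M)
    (hpq : fully_mixed_nash U p q) :
  has_poincare_recurrent_flow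
    (gda_field (n := fun=> 1%N) (m := fun=> 1%N) U
       (fun _ : 'I_N => sigmoid_rV) (fun _ : 'I_M => sigmoid_rV))
  /\
  (forall (n : 'I_N -> nat) (m : 'I_M -> nat)
     (f : forall i, 'rV[R]_(n i) -> R) (g : forall j, 'rV[R]_(m j) -> R),
   (forall i, smooth (f i)) -> (forall j, smooth (g j)) ->
   (forall i x, 0 <= f i x) -> (forall j y, 0 <= g j y) ->
   (forall i, injective (f i)) -> (forall j, injective (g j)) ->
   (forall i, ascent_complete (f i)) -> (forall j, ascent_complete (g j)) ->
   (forall x, safe f g p q x) ->
   has_poincare_recurrent_flow (gda_field U f g)).
Proof.
split.
  apply: (one_dimensional_recurrence hpq) => [i|j]; apply: sigmoid_admissible.
  - exact: (nash_lt1 hpq).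
  - exact: (nash_lt1 (nash_swap hpq)).
move=> n m f g f_smooth g_smooth _ _ f_inj g_inj f_compl g_compl all_safe.
(* Safety speaks of whole states; a point [x] of one block is completed to a
   state by zeros, through a transport along [i' = i] since the blocks have
   different types. *)
have f_safe i x : grad (f i) x <> 0 /\ ascent_values (f i) x (p i 0).
  have [th _] := all_safe (mk_state (fun i' => if i' =P i is ReflectT e then
    ecast i' 'rV[R]_(n i') (esym e) x else 0) (fun=> 0) 0 0).
  have := th i; rewrite /theta_of /mk_state !row_mxKl mxrowK.
  by case: eqP => // e; rewrite eq_axiomK.
have g_safe j y : grad (g j) y <> 0 /\ ascent_values (g j) y (q j 0).
  have [_ ph] := all_safe (mk_state (fun=> 0) (fun j' => if j' =P j is ReflectT e then
    ecast j' 'rV[R]_(m j') (esym e) y else 0) 0 0).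
  have := ph j; rewrite /phi_of /mk_state row_mxKl row_mxKr mxrowK.
  by case: eqP => // e; rewrite eq_axiomK.
have n1 : n = fun=> 1%N.
  by apply/funext => i; apply: safe_smooth_dim (f_smooth i) (f_inj i) (f_safe i 0).1.
have m1 : m = fun=> 1%N.
  by apply/funext => j; apply: safe_smooth_dim (g_smooth j) (g_inj j) (g_safe j 0).1.
(* Every block now has dimension one, and the types become those of the
   one-dimensional game. *)
clear all_safe; subst n m.
apply: (one_dimensional_recurrence hpq) => [i|j]; apply: smooth_admissible => //.
- by move=> x; exact: (f_safe i x).1.
- by have [_ [gam [_ _ [s ->]]]] := f_safe i 0; exists (gam s).
- by move=> y; exact: (g_safe j y).1.
- by have [_ [gam [_ _ [s ->]]]] := g_safe j 0; exists (gam s).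
Qed.
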